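(* Let $\mathfrak{g}=\mathfrak{gl}(1,1)$ and let $Y_q(\mathfrak{g})$ be its $q$-Yangian. (1) A finite-dimensional simple $Y_q(\mathfrak{g})$-module must be of highest $\ell$-weight. (2) Let $S$ be a simple $Y_q(\mathfrak{g})$-module generated by a highest $\ell$-weight vector $v$ with $$|v|=\bar0,\quad s_{ii}(z)v=f_i(z)v,\quad f_i(z)\in(\mathbb{C}[[z]])^\times\quad\text{for }i=1,2.$$ Then $S$ is finite-dimensional if and only if $\frac{f_1(z)}{f_2(z)}=\frac{P(z)}{Q(z)}$ for some polynomials $P(z),Q(z)\in\mathbb{C}[z]$ with non-zero constant terms.
   Context: $q\in\mathbb{C}^\times$ is not a root of unity. All algebras are complex superalgebras ($\mathbb{Z}_2$-graded), modules are $\mathbb{Z}_2$-graded, and tensor products follow the sign rule $(a\otimes b)(a'\otimes b')=(-1)^{|b||a'|}aa'\otimes bb'$. Let $I=\{1,2\}$ with $|1|=\bar 0$, $|2|=\bar 1$, $q_1=q$, $q_2=q^{-1}$. Let $\mathbf{V}=\mathbb{C}v_1\oplus\mathbb{C}v_2$ be the superspace with $|v_i|=|i|$, and $E_{ij}\in\mathrm{End}\,\mathbf{V}$, $E_{ij}v_k=\delta_{jk}v_i$. The Perk-Schultz matrix is $$R(z,w)=\sum_{i}(zq_i-wq_i^{-1})E_{ii}\otimes E_{ii}+(z-w)\sum_{i\neq j}E_{ii}\otimes E_{jj}+z\sum_{i<j}(q_i-q_i^{-1})E_{ji}\otimes E_{ij}+w\sum_{i<j}(q_j-q_j^{-1})E_{ij}\otimes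 E_{ji}.$$ $U_q(\widehat{\mathfrak{g}})$ is the superalgebra generated by $s_{ij}^{(n)},t_{ij}^{(n)}$ ($i,j\in I$, $n\in\mathbb{Z}_{\ge0}$), with $|s_{ij}^{(n)}|=|t_{ij}^{(n)}|=|i|+|j|$, subject to the following relations, where $s_{ij}(z)=\sum_{n\ge0}s_{ij}^{(n)}z^n$, $t_{ij}(z)=\sum_{n\ge0}t_{ij}^{(n)}z^{-n}$, $S(z)=\sum_{i,j}s_{ij}(z)\otimes E_{ij}$, $T(z)=\sum_{i,j}t_{ij}(z)\otimes E_{ij}$ and lower indices indicate the tensor factors of $U_q(\widehat{\mathfrak{g}})\otimes\mathrm{End}\,\mathbf{V}\otimes\mathrm{End}\,\mathbf{V}$: $R_{23}(z,w)T_{12}(z)T_{13}(w)=T_{13}(w)T_{12}(z)R_{23}(z,w)$; $R_{23}(z,w)S_{12}(z)S_{13}(w)=S_{13}(w)S_{12}(z)R_{23}(z,w)$; $R_{23}(z,w)T_{12}(z)S_{13}(w)=S_{13}(w)T_{12}(z)R_{23}(z,w)$; $t_{ij}^{(0)}=s_{ji}^{(0)}=0$ for $i<j$; $t_{ii}^{(0)}s_{ii}^{(0)}=1=s_{ii}^{(0)}t_{ii}^{(0)}$. The $q$-Yangian $Y_q(\mathfrak{g})$ is the subalgebra of $U_q(\widehat{\mathfrak{g}})$ generated by all $s_{ij}^{(n)}$ and $(s_{ii}^{(0)})^{-1}$. A highest $\ell$-weight vector in a $Y_q(\mathfrak{g})$-module is a non-zero $\mathbb{Z}_2$-homogeneous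 vector $v$ with $s_{12}^{(n)}v=0$ and $s_{11}^{(n)}v,\,s_{22}^{(n)}v\in\mathbb{C}v$ for all $n\ge0$. A module is of highest $\ell$-weight if it is generated by a highest $\ell$-weight vector. *)

(* Defs.v *)
From HB Require Import structures.
From mathcomp Require Import all_boot all_order all_algebra.
From mathcomp Require Import generic_quotient ring_quotient.
From mathcomp Require Import finmap monalg.
From mathcomp Require Import boolp reals complex.

Set Implicit Arguments.
Unset Strict Implicit.
Unset Printing Implicit Defensive.

Import GRing.Theory.
Local Open Scope ring_scope.

(* The index set I = {1, 2} is 'I_2; 1 is ix1 = 0 and 2 is ix2 = 1. *)
Notation ix1 := (ord0 : 'I_2).
Notation ix2 := (ord_max : 'I_2).

Definition ipar (i : 'I_2) : bool := i == ix2.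
Definition epar (i j : 'I_2) : bool := ipar i (+) ipar j.

(* A is a superalgebra; sg is its parity involution x |-> (-1)^|x| x. *)
Section Tensor.
Variables (K : fieldType) (A : algType K) (sg : A -> A).

(* X (i, j, k, l) is the coefficient of X at E_ij (x) E_kl. *)
Definition tens : Type := {ffun 'I_2 * 'I_2 * 'I_2 * 'I_2 -> A}.
HB.instance Definition _ := GRing.Lmodule.on tens.

Definition pure (x : A) (i j k l : 'I_2) : tens :=
  [ffun p => if p == (i, j, k, l) then x else 0].

(* (x (x) E_ij (x) E_kl) (y (x) E_jb (x) E_ld)
     = (-1)^(|y| (|E_ij| + |E_kl|) + |E_kl| |E_jb|) xy (x) E_ib (x) E_kd,
   see tmul_pure *)
Definition tmul (X Y : tens) : tens :=
  [ffun p => let: (i, b, k, d) := p in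
     \sum_j \sum_l (-1) ^+ (epar k l && epar j b) *:
       (X (i, j, k, l) *
        (if epar i j (+) epar k l then sg (Y (j, b, l, d))
         else Y (j, b, l, d)))].

Lemma pureE x i j k l i' j' k' l' : pure x i j k l (i', j', k', l') =
  if [&& i' == i, j' == j, k' == k & l' == l] then x else 0.
Proof. by rewrite ffunE !xpair_eqE -!andbA. Qed.

Lemma tmulE (X Y : tens) i b k d : tmul X Y (i, b, k, d) =
  \sum_j \sum_l (-1) ^+ (epar k l && epar j b) *:
     (X (i, j, k, l) *
      (if epar i j (+) epar k l then sg (Y (j, b, l, d))
       else Y (j, b, l, d))).
Proof. by rewrite ffunE. Qed.

Lemma tensZE c (X : tens) p : (c *: X) p = c *: X p.
Proof. by rewrite ffunE. Qed.

Lemma tens0E p : (0 : tens) p = 0.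
Proof. by rewrite ffunE. Qed.

Lemma tensDE (X Y : tens) p : (X + Y) p = X p + Y p.
Proof. by rewrite ffunE. Qed.

Lemma tensNE (X : tens) p : (- X) p = - X p.
Proof. by rewrite ffunE. Qed.

(* y is homogeneous of degree e *)
Lemma tmul_pure (x y : A) (e : bool) i j k l a b c d :
  sg 0 = 0 -> sg y = (-1) ^+ e *: y ->
  tmul (pure x i j k l) (pure y a b c d) =
  ((-1) ^+ ((e && (epar i j (+) epar k l)) (+) (epar k l && epar a b))) *:
    (if (j == a) && (l == c) then pure (x * y) i b k d else 0).
Proof.
move=> sg0 hy; apply/ffunP => -[[[i' b'] k'] d']; rewrite tmulE.
rewrite (bigD1 j) //= [X in _ + X]big1 ?addr0; last first.
  move=> j' nj; apply: big1 => l' _.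
  by rewrite pureE (negPf nj) !andbF mul0r scaler0.
rewrite (bigD1 l) //= [X in _ + X]big1 ?addr0; last first.
  by move=> l' nl; rewrite pureE (negPf nl) !andbF mul0r scaler0.
rewrite tensZE !pureE !eqxx /=.
have [->|ni] := eqVneq i' i; last first.
  by rewrite !mul0r; case: ifP => _; rewrite ?pureE ?(negPf ni) ?tens0E !scaler0.
have [->|nk] := eqVneq k' k; last first.
  by rewrite !mul0r; case: ifP => _;
     rewrite ?pureE ?(negPf nk) ?andbF ?tens0E !scaler0.
have [<-|nj] := eqVneq j a; last by rewrite /= sg0 if_same mulr0 tens0E !scaler0.
have [->|nb] := eqVneq b' b; last first.
  rewrite /= sg0 if_same mulr0; case: ifP => _; last by rewrite tens0E !scaler0.
  by rewrite pureE (negPf nb) andbF !scaler0.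
have [_|nl] := eqVneq l c; last by rewrite /= sg0 if_same mulr0 tens0E !scaler0.
have [->|nd] := eqVneq d' d; last first.
  by rewrite /= sg0 if_same mulr0 pureE (negPf nd) !andbF !scaler0.
rewrite /= pureE !eqxx hy /=; case: (epar i j (+) epar k l); last first.
  by rewrite andbF.
rewrite andbT -scalerAr scalerA; congr (_ *: _).
by case: e {hy} (epar k l && epar j b) => [] [];
   rewrite /= ?expr0 ?expr1 ?mulr1 ?mul1r ?mulrNN ?mulr1.
Qed.

Variable q : K.

Definition qi (i : 'I_2) : K := if i == ix1 then q else q^-1.

(* R_23(z, w) = 1 (x) R(z, w) *)
Definition Rmat (z w : K) : tens :=
    \sum_i pure (z * qi i - w * (qi i)^-1)%:A i i i i
  + (z - w) *: (\sum_(i < 2) \sum_(j < 2 | i != j) pure 1 i i j j)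
  + z *: (\sum_(i < 2) \sum_(j < 2 | (i < j)%N) pure (qi i - (qi i)^-1)%:A j i i j)
  + w *: (\sum_(i < 2) \sum_(j < 2 | (i < j)%N) pure (qi j - (qi j)^-1)%:A i j j i).

Lemma Rmat_lin z w : Rmat z w = z *: Rmat 1 0 + w *: Rmat 0 1.
Proof.
rewrite /Rmat !scale1r !scale0r !addr0 subr0 sub0r scale1r scaleN1r.
rewrite !scalerDr scalerN scalerBl.
rewrite (_ : \sum_i pure (z * qi i - w * (qi i)^-1)%:A i i i i =
   z *: (\sum_i pure (1 * qi i - 0 * (qi i)^-1)%:A i i i i)
 + w *: (\sum_i pure (0 * qi i - 1 * (qi i)^-1)%:A i i i i)); last first.
  rewrite !scaler_sumr -big_split /=; apply: eq_bigr => i _.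
  apply/ffunP => p; rewrite !ffunE; case: ifP => _; last by rewrite !scaler0 addr0.
  by rewrite !mul0r !mul1r subr0 sub0r scalerBl scaleNr scalerN !scalerA.
set a := z *: _; set b := w *: _; set c := z *: _; set d := w *: _.
set e := z *: _; set f := w *: _.
rewrite !addrA; congr (_ + d); rewrite [LHS]addrAC; congr (_ - f).
by rewrite -!addrA; congr (_ + _); rewrite addrCA [b + c]addrC.
Qed.

(* A formal series X(z) in z and 1/z is given by its coefficients: X a i j is
   the coefficient of z^a in X_ij(z). *)
Definition series : Type := int -> 'I_2 -> 'I_2 -> A.

(* the coefficients of z^a in X_12(z) and in X_13(z) *)
Definition leg12 (X : series) (a : int) : tens :=
  \sum_i \sum_j \sum_k pure (X a i j) i j k k.
Definition leg13 (X : series) (a : int) : tens :=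
  \sum_i \sum_j \sum_k pure (X a i j) k k i j.

(* The coefficient of z^a w^b in
     R_23(z,w) X_12(z) Y_13(w) - Y_13(w) X_12(z) R_23(z,w),
   using R(z, w) = z R(1, 0) + w R(0, 1), see Rmat_lin *)
Definition rtt (X Y : series) (a b : int) : tens :=
    tmul (Rmat 1 0) (tmul (leg12 X (a - 1)) (leg13 Y b))
  + tmul (Rmat 0 1) (tmul (leg12 X a) (leg13 Y (b - 1)))
  - (tmul (tmul (leg13 Y b) (leg12 X (a - 1))) (Rmat 1 0)
   + tmul (tmul (leg13 Y (b - 1)) (leg12 X a)) (Rmat 0 1)).

(* The counit s_ij^(n), t_ij^(n) |-> delta_ij delta_n0 of Uq, used below to show
   that Uq is not the zero ring, plays the role of f. *)
Variable f : {rmorphism A -> K}.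
Hypothesis fZ : forall c x, f (c *: x) = c * f x.
Hypothesis fsg : forall x, f (sg x) = f x.

(* f maps X to c times the unit of End V (x) End V. *)
Definition tscalar (c : K) (X : tens) : Prop :=
  forall i j k l, f (X (i, j, k, l)) = c *+ ((i == j) && (k == l)).

Lemma f_tmul_r c X Y : tscalar c Y ->
  forall p, f (tmul X Y p) = f (X p) * c.
Proof.
move=> hY [[[i b] k] d]; rewrite tmulE rmorph_sum (bigD1 b) //=.
rewrite [X in _ + X]big1 ?addr0; last first.
  move=> j nj; rewrite rmorph_sum big1 // => l _.
  by rewrite fZ rmorphM; case: ifP => _; rewrite /= ?fsg hY (negPf nj) !mulr0.
rewrite rmorph_sum (bigD1 d) //= [X in _ + X]big1 ?addr0; last first.
  move=> l nl.
  by rewrite fZ rmorphM; case: ifP => _;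
     rewrite /= ?fsg hY (negPf nl) andbF !mulr0.
rewrite fZ rmorphM /epar addbb andbF mul1r.
by case: ifP => _; rewrite /= ?fsg hY !eqxx.
Qed.

Lemma f_tmul_l c X Y : tscalar c X ->
  forall p, f (tmul X Y p) = c * f (Y p).
Proof.
move=> hX [[[i b] k] d]; rewrite tmulE rmorph_sum (bigD1 i) //=.
rewrite [X in _ + X]big1 ?addr0; last first.
  move=> j nj; rewrite rmorph_sum big1 // => l _.
  by rewrite fZ rmorphM /= hX eq_sym (negPf nj) mul0r mulr0.
rewrite rmorph_sum (bigD1 k) //= [X in _ + X]big1 ?addr0; last first.
  move=> l nl.
  by rewrite fZ rmorphM /= hX [k == l]eq_sym (negPf nl) andbF mul0r mulr0.
by rewrite fZ rmorphM /= hX !eqxx /epar !addbb mul1r.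
Qed.

Lemma tscalar_mul c d X Y :
  tscalar c X -> tscalar d Y -> tscalar (c * d) (tmul X Y).
Proof. by move=> hX hY i j k l; rewrite (f_tmul_l _ hX) hY mulrnAr. Qed.

Definition cseries (X : series) (c : int -> K) : Prop :=
  forall a i j, f (X a i j) = c a *+ (i == j).

Lemma tscalar12 X c a : cseries X c -> tscalar (c a) (leg12 X a).
Proof.
move=> hX i j k l; rewrite sum_ffunE rmorph_sum (bigD1 i) //=.
rewrite [X in _ + X]big1 ?addr0; last first.
  move=> i' ni; rewrite sum_ffunE rmorph_sum big1 // => j' _.
  rewrite sum_ffunE rmorph_sum big1 // => k' _.
  by rewrite pureE [i == i']eq_sym (negPf ni) rmorph0.
rewrite sum_ffunE rmorph_sum (bigD1 j) //= [X in _ + X]big1 ?addr0; last first.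
  move=> j' nj; rewrite sum_ffunE rmorph_sum big1 // => k' _.
  by rewrite pureE [j == j']eq_sym (negPf nj) andbF rmorph0.
rewrite sum_ffunE rmorph_sum (bigD1 k) //= [X in _ + X]big1 ?addr0; last first.
  move=> k' nk.
  by rewrite pureE [k == k']eq_sym (negPf nk) !andbF rmorph0.
rewrite pureE !eqxx /= [l == k]eq_sym.
by case: (k == l); rewrite ?andbT ?andbF ?rmorph0 ?hX.
Qed.

Lemma tscalar13 X c a : cseries X c -> tscalar (c a) (leg13 X a).
Proof.
move=> hX i j k l; rewrite sum_ffunE rmorph_sum (bigD1 k) //=.
rewrite [X in _ + X]big1 ?addr0; last first.
  move=> i' ni; rewrite sum_ffunE rmorph_sum big1 // => j' _.
  rewrite sum_ffunE rmorph_sum big1 // => k' _.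
  by rewrite pureE [k == i']eq_sym (negPf ni) !andbF rmorph0.
rewrite sum_ffunE rmorph_sum (bigD1 l) //= [X in _ + X]big1 ?addr0; last first.
  move=> j' nj; rewrite sum_ffunE rmorph_sum big1 // => k' _.
  by rewrite pureE [l == j']eq_sym (negPf nj) !andbF rmorph0.
rewrite sum_ffunE rmorph_sum (bigD1 i) //= [X in _ + X]big1 ?addr0; last first.
  move=> k' nk.
  by rewrite pureE [i == k']eq_sym (negPf nk) rmorph0.
rewrite pureE !eqxx /= !andbT [j == i]eq_sym.
by case: (i == j); rewrite ?rmorph0 ?hX.
Qed.

Lemma f_rtt X Y c d a b p : cseries X c -> cseries Y d ->
  f (rtt X Y a b p) = 0.
Proof.
move=> hX hY.
have h12 e := tscalar12 e hX; have h13 e := tscalar13 e hY.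
rewrite /rtt !(tensDE, tensNE) rmorphB !rmorphD /=.
rewrite !(f_tmul_r _ (tscalar_mul (h12 _) (h13 _))).
rewrite !(f_tmul_l _ (tscalar_mul (h13 _) (h12 _))).
apply/eqP; rewrite subr_eq0; apply/eqP.
by congr (_ + _); rewrite mulrC [c _ * _]mulrC.
Qed.

End Tensor.

(* (true, i, j, n) stands for s_ij^(n) and (false, i, j, n) for t_ij^(n). *)
Definition gen : Type := (bool * 'I_2 * 'I_2 * nat)%type.
HB.instance Definition _ := Choice.on gen.

Definition gpar (g : gen) : bool := epar g.1.1.2 g.1.2.
Definition wpar (w : {fmonom gen}) : bool :=
  \big[addb/false]_(g <- (w : seq gen)) gpar g.

Definition Free (K : fieldType) : Type := {malg K[{fmonom gen}]}.
HB.instance Definition _ (K : fieldType) := GRing.Lalgebra.on (Free K).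

Fact Free_scalerAr (K : fieldType) (c : K) (x y : Free K) :
  c *: (x * y) = x * (c *: y).
Proof.
apply/malgP => w; rewrite mcoeffZ mcoeffMl.
rewrite (mcoeffMlw (d1 := msupp x) (d2 := msupp y)) ?msuppZ_le //.
rewrite mulr_sumr; apply: eq_bigr => u _.
rewrite mulr_sumr; apply: eq_bigr => v _.
by rewrite mcoeffZ mulrCA mulrnAr.
Qed.
HB.instance Definition _ (K : fieldType) :=
  GRing.Lalgebra_isAlgebra.Build K (Free K) (@Free_scalerAr K).

Section FreeSuper.
Variable K : fieldType.
Local Notation F := (Free K).

Definition gs (i j : 'I_2) (n : nat) : F := << fmu ((true, i, j, n) : gen) >>.
Definition gt (i j : 'I_2) (n : nat) : F := << fmu ((false, i, j, n) : gen) >>.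

Definition Free_homog (a : bool) (x : F) : Prop :=
  forall w, w \in msupp x -> wpar w = a.

(* the parity involution: x |-> (-1)^|x| x on homogeneous x *)
Definition pinv (x : F) : F :=
  [malg w in msupp x => (-1) ^+ wpar w * x@_w].

Lemma pinvE x w : (pinv x)@_w = (-1) ^+ wpar w * x@_w.
Proof. by rewrite mcoeffE; case: msuppP; rewrite ?mulr0. Qed.

Lemma pinv_homog a x : Free_homog a x -> pinv x = (-1) ^+ a *: x.
Proof.
move=> hx; apply/malgP => w; rewrite pinvE mcoeffZ.
by case: msuppP => [/hx -> //|_]; rewrite !mulr0.
Qed.

Definition Ss : series F := fun a i j => if a is Posz n then gs i j n else 0.
Definition Ts : series F := fun a i j => if - a is Posz n then gt i j n else 0.

Variable q : K.

(* The defining relations of Uq are x = 0 for x a relator. *)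
Inductive relator : F -> Prop :=
| relTT a b p : relator (rtt pinv q Ts Ts a b p)
| relSS a b p : relator (rtt pinv q Ss Ss a b p)
| relTS a b p : relator (rtt pinv q Ts Ss a b p)
| relT0 (i j : 'I_2) of (i < j)%N : relator (gt i j 0)
| relS0 (i j : 'I_2) of (i < j)%N : relator (gs j i 0)
| relTS0 i : relator (gt i i 0 * gs i i 0 - 1)
| relST0 i : relator (gs i i 0 * gt i i 0 - 1).

Inductive relideal : F -> Prop :=
| relideal_gen x of relator x : relideal x
| relideal0 : relideal 0
| relidealD x y of relideal x & relideal y : relideal (x + y)
| relidealMl x y of relideal y : relideal (x * y)
| relidealMr x y of relideal x : relideal (x * y).

Definition relidealb : {pred F} := fun x => `[< relideal x >].

Fact relidealb_zmod_closed : zmod_closed relidealb.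
Proof.
split=> [|x y /asboolP hx /asboolP hy]; apply/asboolP.
  exact: relideal0.
by apply: relidealD => //; rewrite -mulN1r; apply: relidealMl.
Qed.
HB.instance Definition _ :=
  GRing.isZmodClosed.Build F relidealb relidealb_zmod_closed.

End FreeSuper.

Section Counit.
Variables (K : fieldType) (q : K).
Local Notation F := (Free K).

Definition counit_gen (g : gen) : K :=
  ((g.1.1.2 == g.1.2) && (g.2 == 0%N))%:R.
Definition counit_word (w : {fmonom gen}) : K :=
  \prod_(g <- (w : seq gen)) counit_gen g.

Fact counit_word_mmorphism : mmorphism counit_word.
Proof.
split=> [u v|]; rewrite /counit_word; last by rewrite fm1 big_nil.
by rewrite fmM big_cat.
Qed.
HB.instance Definition _ :=
  isMultiplicative.Build {fmonom gen} K counit_word counit_word_mmorphism.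

Definition counit : F -> K := mmap idfun counit_word.
HB.instance Definition _ := GRing.RMorphism.on counit.

Lemma counit_s i j n : counit (gs K i j n) = ((i == j) && (n == 0%N))%:R.
Proof. by rewrite /counit mmapU mul1r /counit_word fmuE /= big_seq1. Qed.

Lemma counit_t i j n : counit (gt K i j n) = ((i == j) && (n == 0%N))%:R.
Proof. by rewrite /counit mmapU mul1r /counit_word fmuE /= big_seq1. Qed.

Lemma counitZ c x : counit (c *: x) = c * counit x.
Proof. exact: mmap_is_linear. Qed.

Lemma counit_word_odd w : wpar w -> counit_word w = 0.
Proof.
rewrite /wpar /counit_word; elim: (w : seq gen) => [|g s IH]; rewrite ?big_nil //.
rewrite !big_cons /counit_gen /gpar /epar.
have [-> |_] := eqVneq; last by rewrite mul0r.
by rewrite addbb /= => /IH ->; rewrite mulr0.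
Qed.

Lemma counit_pinv x : counit (pinv x) = counit x.
Proof.
rewrite /counit (mmapEw (d := msupp x)); last first.
  apply/fsubsetP => w; rewrite -!mcoeff_neq0 pinvE.
  by apply: contra => /eqP ->; rewrite mulr0.
rewrite mmapE; apply: eq_bigr => w _ /=; rewrite pinvE.
by case: (boolP (wpar w)) => [/counit_word_odd ->|_]; rewrite ?mulr0 ?mul1r.
Qed.

Lemma cseriesS : cseries counit (@Ss K) (fun a => (a == 0)%:R).
Proof.
move=> [n|n] i j; rewrite /Ss; last by rewrite rmorph0 mul0rn.
rewrite /= counit_s andbC -mulrnA mulnb; case: n => [|n] //.
Qed.

Lemma cseriesT : cseries counit (@Ts K) (fun a => (a == 0)%:R).
Proof.
move=> a i j; rewrite /Ts -[a == 0]oppr_eq0; case: (- a) => [n|n]; last first.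
  by rewrite rmorph0 mul0rn.
rewrite /= counit_t andbC -mulrnA mulnb; case: n => [|n] //.
Qed.

Lemma counit_relator x : relator q x -> counit x = 0.
Proof.
have frtt := f_rtt (sg := @pinv K) q counitZ counit_pinv.
case=> {x} [a b p|a b p|a b p|i j ij|i j ij|i|i].
- exact: frtt _ _ cseriesT cseriesT.
- exact: frtt _ _ cseriesS cseriesS.
- exact: frtt _ _ cseriesT cseriesS.
- by rewrite counit_t -val_eqE (ltn_eqF ij).
- by rewrite counit_s -val_eqE (gtn_eqF ij).
- by rewrite rmorphB rmorphM rmorph1 /= counit_t counit_s eqxx mulr1 subrr.
- by rewrite rmorphB rmorphM rmorph1 /= counit_t counit_s eqxx mulr1 subrr.
Qed.

Lemma counit_relideal x : relideal q x -> counit x = 0.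
Proof.
elim=> {x} [x /counit_relator hx||x y _ hx _ hy|x y _ hy|x y _ hx].
- exact: hx.
- exact: rmorph0.
- by rewrite rmorphD /= hx hy addr0.
- by rewrite rmorphM /= hy mulr0.
- by rewrite rmorphM /= hx mul0r.
Qed.

Lemma relideal1 : ~ relideal q 1.
Proof. by move/counit_relideal/eqP; rewrite rmorph1 oner_eq0. Qed.

End Counit.

(* the quantum affine superalgebra of gl(1,1) with parameter q *)
Definition Uq (K : fieldType) (q : K) : Type := (Quotient.quot (relidealb q)).

Section Quotient.
Variables (K : fieldType) (q : K).
Local Notation F := (Free K).
Local Notation U := (Uq q).
Local Open Scope quotient_scope.

HB.instance Definition _ := GRing.Zmodule.on U.

Definition Upi (x : F) : U := \pi_((Quotient.quot (relidealb q))) x.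

Lemma Upi_eq x y : Upi x = Upi y <-> relideal q (x - y).
Proof.
split=> [/eqP|h].
  by rewrite -Quotient.idealrBE => /asboolP.
by apply/eqP; rewrite -Quotient.idealrBE; apply/asboolP.
Qed.

Definition Urepr (u : U) : F := repr (u : (Quotient.quot (relidealb q))).
Lemma UreprK u : Upi (Urepr u) = u. Proof. exact: reprK. Qed.

Lemma UpiD x y : Upi (x + y) = Upi x + Upi y.
Proof. exact: (Quotient.pi_add (relidealb q) x y). Qed.

Lemma Upi0 : Upi 0 = 0.
Proof. by apply: (addrI (Upi 0)); rewrite -UpiD !addr0. Qed.

Definition U1 : U := Upi 1.
Definition Umul (u v : U) : U := Upi (Urepr u * Urepr v).
Definition Uscale (c : K) (u : U) : U := Upi (c *: Urepr u).

Lemma UpiM x y : Umul (Upi x) (Upi y) = Upi (x * y).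
Proof.
apply/Upi_eq.
have hx : relideal q (Urepr (Upi x) - x) by apply/Upi_eq; rewrite UreprK.
have hy : relideal q (Urepr (Upi y) - y) by apply/Upi_eq; rewrite UreprK.
set x' := Urepr _; set y' := Urepr _.
have -> : x' * y' - x * y = x' * (y' - y) + (x' - x) * y.
  by rewrite mulrBr mulrBl addrA subrK.
by apply: relidealD; [apply: relidealMl | apply: relidealMr].
Qed.

Lemma UpiZ c x : Uscale c (Upi x) = Upi (c *: x).
Proof.
apply/Upi_eq; rewrite -scalerBr -[_ - x]mul1r scalerAl.
by apply: relidealMl; apply/Upi_eq; rewrite UreprK.
Qed.

Fact UmulA : associative Umul.
Proof.
by move=> u v w; rewrite -[u]UreprK -[v]UreprK -[w]UreprK !UpiM mulrA.
Qed.
Fact Umul1u : left_id U1 Umul.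
Proof. by move=> u; rewrite -[u]UreprK UpiM mul1r. Qed.
Fact Umulu1 : right_id U1 Umul.
Proof. by move=> u; rewrite -[u]UreprK UpiM mulr1. Qed.
Fact UmulDl : left_distributive Umul +%R.
Proof.
move=> u v w; rewrite -[u]UreprK -[v]UreprK -[w]UreprK.
by rewrite -UpiD !UpiM mulrDl UpiD.
Qed.
Fact UmulDr : right_distributive Umul +%R.
Proof.
move=> u v w; rewrite -[u]UreprK -[v]UreprK -[w]UreprK.
by rewrite -UpiD !UpiM mulrDr UpiD.
Qed.
Fact Uone_neq0 : U1 != 0.
Proof.
apply/eqP => h; apply: (@relideal1 K q).
by rewrite -[1]subr0; apply/Upi_eq; rewrite -/U1 h Upi0.
Qed.
HB.instance Definition _ := GRing.Zmodule_isNzRing.Build U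
  UmulA Umul1u Umulu1 UmulDl UmulDr Uone_neq0.

Fact UscaleA c d u : Uscale c (Uscale d u) = Uscale (c * d) u.
Proof. by rewrite -[u]UreprK !UpiZ scalerA. Qed.
Fact Uscale1 : left_id 1 Uscale.
Proof. by move=> u; rewrite -[u]UreprK UpiZ scale1r. Qed.
Fact UscaleDr : right_distributive Uscale +%R.
Proof.
by move=> c u v; rewrite -[u]UreprK -[v]UreprK -UpiD !UpiZ scalerDr UpiD.
Qed.
Fact UscaleDl u : {morph Uscale^~ u : c d / c + d}.
Proof. by move=> c d; rewrite -[u]UreprK !UpiZ scalerDl UpiD. Qed.
HB.instance Definition _ := GRing.Zmodule_isLmodule.Build K U
  UscaleA Uscale1 UscaleDr UscaleDl.

Fact UscaleAl (c : K) (u v : U) : c *: (u * v) = (c *: u) * v.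
Proof.
rewrite -[u]UreprK -[v]UreprK.
by rewrite /GRing.mul /GRing.scale /= !(UpiM, UpiZ) scalerAl.
Qed.
HB.instance Definition _ := GRing.Lmodule_isLalgebra.Build K U UscaleAl.
Fact UscaleAr (c : K) (u v : U) : c *: (u * v) = u * (c *: v).
Proof.
rewrite -[u]UreprK -[v]UreprK.
by rewrite /GRing.mul /GRing.scale /= !(UpiM, UpiZ) scalerAr.
Qed.
HB.instance Definition _ := GRing.Lalgebra_isAlgebra.Build K U UscaleAr.

Fact Upi_is_zmod_morphism : zmod_morphism Upi.
Proof. by move=> x y; apply: (addIr (Upi y)); rewrite -UpiD !subrK. Qed.
HB.instance Definition _ :=
  GRing.isZmodMorphism.Build F U Upi Upi_is_zmod_morphism.
Fact Upi_is_monoid_morphism : monoid_morphism Upi.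
Proof. by split=> // x y; rewrite -UpiM. Qed.
HB.instance Definition _ :=
  GRing.isMonoidMorphism.Build F U Upi Upi_is_monoid_morphism.
Fact Upi_is_scalable : scalable Upi.
Proof. by move=> c x; rewrite -UpiZ. Qed.
HB.instance Definition _ :=
  GRing.isScalable.Build K F U *:%R Upi Upi_is_scalable.

Lemma Upi_eq0 x : Upi x = 0 <-> relideal q x.
Proof. by rewrite -[X in relideal q X]subr0 -Upi_eq rmorph0. Qed.

Definition Us (i j : 'I_2) (n : nat) : U := Upi (gs K i j n).
Definition Ut (i j : 'I_2) (n : nat) : U := Upi (gt K i j n).

Lemma UtsK i : Ut i i 0 * Us i i 0 = 1.
Proof.
rewrite -rmorphM -(rmorph1 Upi); apply/Upi_eq.
exact/relideal_gen/relTS0.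
Qed.
Lemma UstK i : Us i i 0 * Ut i i 0 = 1.
Proof.
rewrite -rmorphM -(rmorph1 Upi); apply/Upi_eq.
exact/relideal_gen/relST0.
Qed.

Definition Uq_homog (a : bool) (u : U) : Prop :=
  exists2 x : F, Free_homog a x & u = Upi x.

(* The q-Yangian: (s_ii^(0))^-1 is t_ii^(0), see UtsK and UstK. *)
Inductive in_Yq : U -> Prop :=
| inYq_s i j n : in_Yq (Us i j n)
| inYq_sV i : in_Yq (Ut i i 0)
| inYq1 : in_Yq 1
| inYqZ (c : K) u of in_Yq u : in_Yq (c *: u)
| inYqD u v of in_Yq u & in_Yq v : in_Yq (u + v)
| inYqM u v of in_Yq u & in_Yq v : in_Yq (u * v).

Definition in_Yqb : {pred U} := fun u => `[< in_Yq u >].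

Fact in_Yqb_subalg_closed : GRing.subsemialg_closed in_Yqb.
Proof.
split; first exact/asboolP/inYq1.
- split=> [|u v /asboolP hu /asboolP hv]; apply/asboolP; last exact: inYqD.
  by rewrite -(scale0r 1); apply/inYqZ/inYq1.
- by move=> c u /asboolP hu; apply/asboolP/inYqZ.
- by move=> u v /asboolP hu /asboolP hv; apply/asboolP/inYqM.
Qed.
HB.instance Definition _ :=
  GRing.isSubalgClosed.Build K U in_Yqb in_Yqb_subalg_closed.

Record Yq : Type := MkYq { Yval : U; _ : Yval \in in_Yqb }.

HB.instance Definition _ := [isSub for Yval].
HB.instance Definition _ := [Choice of Yq by <:].
HB.instance Definition _ := [SubChoice_isSubAlgebra of Yq by <:].

End Quotient.

Section YqModules.
Variables (K : fieldType) (q : K).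
Local Notation Y := (Yq q).

Fact Ys_subproof i j n : Us q i j n \in @in_Yqb K q.
Proof. exact/asboolP/inYq_s. Qed.

Definition Ys (i j : 'I_2) (n : nat) : Y := MkYq (Ys_subproof i j n).

Definition Yq_homog (a : bool) (y : Y) : Prop := Uq_homog a (Yval y).

(* A Yq-module is Z_2-graded: part false and part true are the even and the odd
   part, which are stable under scalars since these are of degree 0 in Yq. *)
Record supermodule : Type := Supermodule {
  smod_sort :> lmodType Y;
  part : bool -> smod_sort -> Prop;
  part0 : forall a, part a 0;
  partD : forall a u v, part a u -> part a v -> part a (u + v);
  part_act : forall a b y v,
    Yq_homog a y -> part b v -> part (a (+) b) (y *: v);
  part_dec : forall v, exists v0 v1,
    [/\ part false v0, part true v1 & v = v0 + v1];
  part_disj : forall v, part false v -> part true v -> v = 0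
}.

Section Module.
Variable V : supermodule.

(* Complex scalars act on V through the scalars c%:A of Yq. *)
Definition fin_dim : Prop :=
  exists n (b : 'I_n -> V), forall v : V, exists c : 'I_n -> K,
    v = \sum_(i < n) (c i)%:A *: b i.

Definition graded_submodule (W : V -> Prop) : Prop :=
  [/\ W 0,
      forall u v, W u -> W v -> W (u + v),
      forall (y : Y) v, W v -> W (y *: v)
    & forall v, W v -> exists v0 v1,
        [/\ W v0 /\ part false v0, W v1 /\ part true v1 & v = v0 + v1]].

Definition simple_module : Prop :=
  (exists v : V, v != 0) /\
  forall W : V -> Prop, graded_submodule W ->
    (forall v, W v -> v = 0) \/ (forall v, W v).

Definition generated_by (v : V) : Prop :=
  forall u : V, exists y : Y, u = y *: v.

Definition hlw_vector (v : V) : Prop :=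
  [/\ v != 0,
      part false v \/ part true v,
      forall n, Ys ix1 ix2 n *: v = 0
    & forall n, (exists c : K, Ys ix1 ix1 n *: v = c%:A *: v) /\
                (exists c : K, Ys ix2 ix2 n *: v = c%:A *: v)].

Definition highest_lweight : Prop :=
  exists v : V, hlw_vector v /\ generated_by v.

End Module.
End YqModules.

Section PowerSeries.
Variable K : fieldType.

(* f n is the coefficient of z^n. *)
Definition pseries : Type := nat -> K.
Implicit Types f g : pseries.

Definition ps_one : pseries := fun n => (n == 0%N)%:R.
Definition ps_mul f g : pseries := fun n => \sum_(k < n.+1) f k * g (n - k)%N.
Definition ps_unit f : Prop := exists g, ps_mul f g =1 ps_one.
Definition ps_of_poly (P : {poly K}) : pseries := fun n => P`_n.

(* the coefficients up to z^n of the inverse of f, see ps_mulV *)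
Fixpoint ps_inv_seq f (n : nat) : seq K :=
  if n is m.+1 then
    let g := ps_inv_seq f m in
    rcons g (- (f 0%N)^-1 * \sum_(k < m.+1) f (m.+1 - k)%N * g`_k)
  else [:: (f 0%N)^-1].
Definition ps_inv f : pseries := fun n => (ps_inv_seq f n)`_n.
Definition ps_div f g : pseries := ps_mul f (ps_inv g).

Lemma size_ps_inv_seq f n : size (ps_inv_seq f n) = n.+1.
Proof. by elim: n => //= n IH; rewrite size_rcons IH. Qed.

Lemma nth_ps_inv_seq f n k : (k <= n)%N -> (ps_inv_seq f n)`_k = ps_inv f k.
Proof.
elim: n => [|n IH]; first by case: k.
rewrite leq_eqVlt => /predU1P [-> //|kn] /=.
by rewrite nth_rcons size_ps_inv_seq kn IH.
Qed.

Lemma ps_invS f n : ps_inv f n.+1 =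
  - (f 0%N)^-1 * \sum_(k < n.+1) f (n.+1 - k)%N * ps_inv f k.
Proof.
rewrite {1}/ps_inv /= nth_rcons size_ps_inv_seq ltnn eqxx; congr (_ * _).
by apply: eq_bigr => k _; rewrite nth_ps_inv_seq // -ltnS.
Qed.

Lemma ps_mulV f : f 0%N != 0 -> ps_mul f (ps_inv f) =1 ps_one.
Proof.
move=> f0 [|n]; rewrite /ps_mul.
  by rewrite big_ord_recl big_ord0 addr0 subnn /ps_inv /= divff.
rewrite big_ord_recl subn0 /= ps_invS mulrA mulrN divff // mulN1r.
rewrite (reindex_inj rev_ord_inj) /=; apply/eqP; rewrite addrC subr_eq0.
apply/eqP; apply: eq_bigr => k _; rewrite /bump /= add1n subSS subSn //.
  by rewrite subKn // -ltnS.
exact: leq_subr.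
Qed.

Lemma ps_unitP f : ps_unit f <-> f 0%N != 0.
Proof.
split=> [[g /(_ 0%N)]|/ps_mulV]; last by exists (ps_inv f).
rewrite /ps_mul /ps_one big_ord_recl big_ord0 addr0 /=.
by apply: contra_eq_neq => ->; rewrite mul0r eq_sym oner_eq0.
Qed.

End PowerSeries.

(* Main.v *)
Require Import Defs.
From mathcomp Require Import all_boot all_order all_algebra.
From mathcomp Require Import finmap monalg.
From mathcomp Require Import boolp reals complex ring zify.

Set Implicit Arguments.
Unset Strict Implicit.
Unset Printing Implicit Defensive.

Import GRing.Theory.
Local Open Scope ring_scope.

(** Write k(z), e(z), x(z), h(z) for s11(z), s12(z), s21(z), s22(z). Taking
    components of the RTT relation gives exchange relations between the
    coefficients, in which e and x are odd and move the eigenvalue of k_0 by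
    the factors q and 1/q respectively, and in which e(z)x(w) + x(w)e(z) is a
    combination of h(z)k(w) and h(w)k(z) divided by z - w. Call a vector
    singular when all e_n kill it.

    Existence of a highest weight vector. On a finite-dimensional module k_0
    has an eigenvector with non-zero eigenvalue. As q is not a root of unity,
    iterating the operators e_n on it gives eigenvectors with distinct
    eigenvalues, so it ends with a non-zero singular vector
    ([exists_singular]), and there is a homogeneous one since singularity is a
    graded condition. All k_n and h_n preserve the singular
    vectors and commute on them ([singular_stable], [singular_kh]), so they
    have a common homogeneous eigenvector there ([commuting_eigenvector]). It
    generates the module by simplicity.

    Finite dimension implies rationality. Let v have eigenvalues f1, f2. A
    dependence between x_1 v, x_2 v, ... is a linear functional l on sequences;
    applying every e_a to it gives f2 l(f1) = f1 l(f2), where l(f) is the series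
    of the values of l on the shifts of f ([e_contract]). Multiplying f1 and f2
    by the polynomial r reciprocal to l gives r fi = pi + z^(N+1) l(fi) with pi
    a polynomial, whence f1 p2 = f2 p1 ([finspan_rational]).

    Rationality implies finite dimension. If f1 Q = P f2, put u = Q / f2, so
    that u f1 = P and u f2 = Q are polynomials. The coefficients of u(z)x(z)v of
    large degree are then singular vectors of a weight below that of v
    ([xtwist_singular]). Such a vector generates a graded submodule spanned by
    words in the x_n applied to singular vectors of the same weight
    ([xspan_stable], [xspan_e]), so all weights in it are below that of v and
    simplicity forces it to vanish ([xspan_weight], [no_singular]). Hence
    x_n v is a combination of the x_m v with m < n as soon as n >= D. The module
    is spanned by the words in the x_n applied to v ([xspan_line]). The
    quadratic relations between the x_n rewrite every word into words with
    strictly increasing letters of the same sum ([x_straighten], [xword_strict]); since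
    the reduction of the last letter lowers the sum, the words with strictly
    increasing letters below D span, and there are at most 2^D of them
    ([xword_good], [good_word_fin]). *)

(** * Linear identities between vectors *)

(** Syntactic linear combinations of atoms, the vectors of a list. They serve
    to prove linear identities between vectors by comparing coefficients. *)
Inductive lexp (K : Type) : Type :=
| LVar of nat
| LZero
| LAdd of lexp K & lexp K
| LOpp of lexp K
| LScale of K & lexp K.

(** The coefficient of the [i]-th atom *)
Fixpoint lcoef (K : fieldType) (e : lexp K) (i : nat) : K :=
  match e with
  | LVar n => if i == n then 1 else 0
  | LZero => 0
  | LAdd a b => lcoef a i + lcoef b i
  | LOpp a => - lcoef a i
  | LScale c a => c * lcoef a i
  end.

(** The scalar action [sc] is a parameter: a module over an algebra [A] has
    the action [c%:A *: u] of the base field. *)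
Section LinearExpressions.
Variables (K : fieldType) (V : zmodType) (sc : K -> V -> V).
Hypothesis scDl : forall c d u, sc (c + d) u = sc c u + sc d u.
Hypothesis scDr : forall c u v, sc c (u + v) = sc c u + sc c v.
Hypothesis scA : forall c d u, sc c (sc d u) = sc (c * d) u.
Hypothesis sc1 : forall u, sc 1 u = u.

Fixpoint leval (env : seq V) (e : lexp K) : V :=
  match e with
  | LVar n => env`_n
  | LZero => 0
  | LAdd a b => leval env a + leval env b
  | LOpp a => - leval env a
  | LScale c a => sc c (leval env a)
  end.

Fixpoint lsum (env : seq V) (f : nat -> K) : V :=
  if env is u :: env' then sc (f 0%N) u + lsum env' (fun i => f i.+1) else 0.

Lemma sc0l u : sc 0 u = 0.
Proof. by apply: (addrI (sc 0 u)); rewrite -scDl !addr0. Qed.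

Lemma sc0r c : sc c 0 = 0.
Proof. by apply: (addrI (sc c 0)); rewrite -scDr !addr0. Qed.

Lemma lsum_eq env f g : (forall i, (i < size env)%N -> f i = g i) ->
  lsum env f = lsum env g.
Proof.
elim: env f g => //= u env IH f g fg; rewrite (fg 0%N) //; congr (_ + _).
by apply: IH => i ie; apply: fg.
Qed.

Lemma lsum0 env : lsum env (fun=> 0) = 0.
Proof. by elim: env => //= u env ->; rewrite sc0l addr0. Qed.

Lemma lsumD env f g :
  lsum env (fun i => f i + g i) = lsum env f + lsum env g.
Proof.
elim: env f g => [|u env IH] f g /=; first by rewrite addr0.
by rewrite IH scDl addrACA.
Qed.

Lemma lsumZ env c f : lsum env (fun i => c * f i) = sc c (lsum env f).
Proof.
elim: env f => [|u env IH] f /=; first by rewrite sc0r.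
by rewrite IH scDr scA.
Qed.

Lemma lsum_var env n : lsum env (fun i => if i == n then 1 else 0) = env`_n.
Proof.
elim: env n => [|u env IH] [|n] //=; first by rewrite lsum0 sc1 addr0.
by rewrite sc0l add0r -IH; apply: lsum_eq.
Qed.

Lemma leval_lsum env e : leval env e = lsum env (lcoef e).
Proof.
elim: e => [n||a IHa b IHb|a IHa|c a IHa] /=.
- by rewrite lsum_var.
- by rewrite lsum0.
- by rewrite lsumD IHa IHb.
- apply: (addrI (leval env a)); rewrite subrr IHa -lsumD.
  by rewrite (lsum_eq (g := fun=> 0)) ?lsum0 // => i _; rewrite subrr.
- by rewrite lsumZ IHa.
Qed.

Lemma leval_eq env e1 e2 : 
  foldr (fun i P => lcoef e1 i = lcoef e2 i /\ P) True (iota 0 (size env)) ->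
  leval env e1 = leval env e2.
Proof.
move=> H; rewrite !leval_lsum; apply: lsum_eq => i ie.
have : i \in iota 0 (size env) by rewrite mem_iota.
by elim: (iota _ _) H => //= j s IH [ej es];
  rewrite inE => /predU1P [-> //|/IH]; apply.
Qed.

End LinearExpressions.

Ltac lin_index u env :=
  lazymatch env with
  | u :: _ => constr:(0%N)
  | _ :: ?env' => let n := lin_index u env' in constr:(S n)
  end.

(** Both [c *: u] with [c] in [K] and [c%:A *: u] count as multiples of [u];
    the action of any other scalar forms an atom. *)
Ltac lin_atoms K u env :=
  let atom := lazymatch env with
              | context [u :: _] => env
              | _ => constr:(u :: env)
              end in
  lazymatch u with
  | GRing.zero => env
  | GRing.add ?a ?b => let env := lin_atoms K a env in lin_atoms K b env
  | GRing.opp ?a => lin_atoms K a env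
  | @GRing.scale _ _ ?s ?a =>
      lazymatch s with
      | @GRing.scale _ _ _ _ => lin_atoms K a env
      | _ => match goal with
             | _ => let s' := constr:(s : K) in lin_atoms K a env
             | _ => atom
             end
      end
  | _ => atom
  end.

Ltac lin_reify K u env :=
  lazymatch u with
  | GRing.zero => constr:(@LZero K)
  | GRing.add ?a ?b =>
      let a := lin_reify K a env in let b := lin_reify K b env in
      constr:(@LAdd K a b)
  | GRing.opp ?a => let a := lin_reify K a env in constr:(@LOpp K a)
  | @GRing.scale _ _ ?s ?a =>
      lazymatch s with
      | @GRing.scale _ _ ?c _ =>
          let a := lin_reify K a env in constr:(@LScale K c a)
      | _ => match goal with
             | _ => let s' := constr:(s : K) in
                    let a := lin_reify K a env in constr:(@LScale K s a)
             | _ => let n := lin_index u env in constr:(@LVar K n)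
             end
      end
  | _ => let n := lin_index u env in constr:(@LVar K n)
  end.

(** [linear_with K lem] replaces an equality of vectors by the equalities of
    the coefficients of the atoms; [lem] is [leval_eq] for the action at hand.
      *)
Ltac linear_with K lem :=
  lazymatch goal with
  | |- @eq ?V ?u ?v =>
      let env := lin_atoms K u (@nil V) in
      let env := lin_atoms K v env in
      let e1 := lin_reify K u env in
      let e2 := lin_reify K v env in
      refine (lem env e1 e2 _); rewrite /=; repeat split
  end.

Section AlgebraLinear.
Variables (K : fieldType) (A : lmodType K).
Lemma leval_eq_alg (env : seq A) (e1 e2 : lexp K) :
  foldr (fun i P => lcoef e1 i = lcoef e2 i /\ P) True (iota 0 (size env)) ->
  leval (fun c u => c *: u) env e1 = leval (fun c u => c *: u) env e2.
Proof.
apply: leval_eq => *; [exact: scalerDl | exact: scalerDr | exact: scalerA |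
  exact: scale1r].
Qed.

Lemma eq_of_multiple (x y l r : A) (c : K) :
  l = r -> x - y = c *: (l - r) -> x = y.
Proof. by move=> ->; rewrite subrr scaler0 => /eqP;
  rewrite subr_eq0 => /eqP. Qed.
End AlgebraLinear.

Section ModLinear.
Variables (K : fieldType) (A : algType K) (V : lmodType A).
Lemma leval_eq_mod (env : seq V) (e1 e2 : lexp K) :
  foldr (fun i P => lcoef e1 i = lcoef e2 i /\ P) True (iota 0 (size env)) ->
  leval (fun (c : K) u => (c%:A : A) *: u) env e1 = leval (fun (c : K) u =>
    (c%:A : A) *: u) env e2.
Proof.
apply: leval_eq.
- by move=> c d u; rewrite scalerDl scalerDl.
- by move=> c u v; rewrite scalerDr.
- by move=> c d u; rewrite scalerA -scalerAl mul1r scalerA.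
- by move=> u; rewrite !scale1r.
Qed.
End ModLinear.

(** * The RTT relation in components *)

Lemma big_ord2 (V : nmodType) (P : pred 'I_2) (F : 'I_2 -> V) :
  \sum_(i < 2 | P i) F i =
  (if P ix1 then F ix1 else 0) + (if P ix2 then F ix2 else 0).
Proof.
rewrite big_mkcond !big_ord_recl big_ord0 Monoid.mulm1.
by rewrite (_ : lift ord0 ord0 = ix2) //; apply/val_inj.
Qed.

Lemma ord2P (m : 'I_2) : m = ix1 \/ m = ix2.
Proof. by case: m => [[|[|]]] // H; [left|right]; apply/val_inj. Qed.

Section RTT.
Variables (K : fieldType) (A : algType K) (sg : A -> A) (q : K).
Variables (X Y : series A).
Hypothesis sg0 : sg 0 = 0.
Hypothesis sgK : forall c : K, sg c%:A = c%:A.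
Hypothesis sgX : forall a i j, sg (X a i j) = (-1) ^+ epar i j *: X a i j.
Hypothesis sgY : forall a i j, sg (Y a i j) = (-1) ^+ epar i j *: Y a i j.

(** The coefficient of [R(z, w)] at E_ij (x) E_kl *)
Definition Rcoef (z w : K) (i j k l : 'I_2) : K :=
  if (i == j) && (k == l) then
    if i == k then z * qi q i - w * (qi q i)^-1 else z - w
  else if (i == l) && (j == k) then
    if (j < i)%N then z * (q - q^-1) else w * (q^-1 - q)
  else 0.

Lemma RmatE z w i j k l : Rmat A q z w (i, j, k, l) = (Rcoef z w i j k l)%:A.
Proof.
have -> : Rmat A q z w =
   pure (z * q - w * q^-1)%:A ix1 ix1 ix1 ix1
 + pure (z * q^-1 - w * q)%:A ix2 ix2 ix2 ix2
 + (z - w) *: (pure 1 ix1 ix1 ix2 ix2 + pure 1 ix2 ix2 ix1 ix1)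
 + z *: pure (q - q^-1)%:A ix2 ix1 ix1 ix2
 + w *: pure (q^-1 - q)%:A ix1 ix2 ix2 ix1.
  by rewrite /Rmat !big_ord2 /= !(addr0, add0r) /qi /= invrK.
rewrite !(tensDE, tensZE) !pureE /Rcoef /qi.
case: (ord2P i) => ->; case: (ord2P j) => ->;
case: (ord2P k) => ->; case: (ord2P l) => -> /=;
by rewrite ?invrK ?(scaler0, scale0r, addr0, add0r) ?scalerA.
Qed.

Lemma leg12E (Z : series A) a i j k l :
  leg12 Z a (i, j, k, l) = if k == l then Z a i j else 0.
Proof.
rewrite /leg12 !big_ord2 /= !tensDE !pureE.
by case: (ord2P i) => ->; case: (ord2P j) => ->;
   case: (ord2P k) => ->; case: (ord2P l) => -> /=; rewrite ?(addr0, add0r).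
Qed.

Lemma leg13E (Z : series A) a i j k l :
  leg13 Z a (i, j, k, l) = if i == j then Z a k l else 0.
Proof.
rewrite /leg13 !big_ord2 /= !tensDE !pureE.
by case: (ord2P i) => ->; case: (ord2P j) => ->;
   case: (ord2P k) => ->; case: (ord2P l) => -> /=; rewrite ?(addr0, add0r).
Qed.

(** The sign is that of moving the second series past E_ij. *)
Lemma tmul1213 a b i j k l : tmul sg (leg12 X a) (leg13 Y b) (i, j, k, l) =
  (-1) ^+ (epar i j && epar k l) *: (X a i j * Y b k l).
Proof.
rewrite tmulE !big_ord2 /= !leg12E !leg13E.
case: (ord2P i) => ->; case: (ord2P j) => ->;
case: (ord2P k) => ->; case: (ord2P l) => -> /=;
by rewrite ?sgY ?sg0 /= ?expr0 ?expr1 ?(mulr0, mul0r, scaler0, addr0, add0r,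
  scale1r, scaleN1r, mulrN, oppr0, subr0).
Qed.

Lemma tmul1312 a b i j k l : tmul sg (leg13 Y b) (leg12 X a) (i, j, k, l) =
  Y b k l * X a i j.
Proof.
rewrite tmulE !big_ord2 /= !leg12E !leg13E.
case: (ord2P i) => ->; case: (ord2P j) => ->;
case: (ord2P k) => ->; case: (ord2P l) => -> /=;
by rewrite ?sgX ?sg0 /= ?expr0 ?expr1 ?(mulr0, mul0r, scaler0, addr0, add0r,
  scale1r, scaleN1r, mulrN, opprK, oppr0, subr0).
Qed.

End RTT.

Section RowCol.
Variables (K : fieldType) (q : K).

(** Left and right multiplication by [R(z, w)], on the coefficients [T i b k d]
    at E_ib (x) E_kd. *)
Definition rowR (V : lmodType K) z w (T : 'I_2 -> 'I_2 -> 'I_2 -> 'I_2 -> V)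
    i b k d : V :=
  if i == k then (z * qi q i - w * (qi q i)^-1) *: T i b k d
  else (z - w) *: T i b k d
     + (-1) ^+ epar k b *: ((if (k < i)%N then z * (q - q^-1)
                             else w * (q^-1 - q)) *: T k b i d).

Definition colR (V : lmodType K) z w (T : 'I_2 -> 'I_2 -> 'I_2 -> 'I_2 -> V)
    i b k d : V :=
  if b == d then (z * qi q b - w * (qi q b)^-1) *: T i b k d
  else (z - w) *: T i b k d
     + (-1) ^+ epar k b *: ((if (b < d)%N then z * (q - q^-1)
                             else w * (q^-1 - q)) *: T i d k b).

Section Linear.
Variables (V W : lmodType K) (f : V -> W).
Hypothesis fD : forall u v, f (u + v) = f u + f v.
Hypothesis fZ : forall c u, f (c *: u) = c *: f u.

Lemma rowR_lin z w T i b k d :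
  f (rowR z w T i b k d) = rowR z w (fun i b k d => f (T i b k d)) i b k d.
Proof. by rewrite /rowR; case: (i == k); rewrite ?fD !fZ. Qed.

Lemma colR_lin z w T i b k d :
  f (colR z w T i b k d) = colR z w (fun i b k d => f (T i b k d)) i b k d.
Proof. by rewrite /colR; case: (b == d); rewrite ?fD !fZ. Qed.
End Linear.

(** The coefficients of z^a w^b in X_12(z) X_13(w) and X_13(w) X_12(z) *)
Definition ltens (A : algType K) (X : int -> 'I_2 -> 'I_2 -> A) a b i j k l :
  A :=
  (-1) ^+ (epar i j && epar k l) *: (X a i j * X b k l).
Definition rtens (A : algType K) (X : int -> 'I_2 -> 'I_2 -> A) a b i j k l :
  A :=
  X b k l * X a i j.

End RowCol.

Section RTTeq.
Variables (K : fieldType) (A : algType K) (sg : A -> A) (q : K).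
Variable X : series A.
Hypothesis sg0 : sg 0 = 0.
Hypothesis sgK : forall c : K, sg c%:A = c%:A.
Hypothesis sgX : forall a i j, sg (X a i j) = (-1) ^+ epar i j *: X a i j.

Lemma tmulRl z w T i b k d : tmul sg (Rmat A q z w) T (i, b, k, d) =
  rowR q z w (fun i b k d => T (i, b, k, d)) i b k d.
Proof.
rewrite /rowR tmulE !big_ord2 !RmatE /Rcoef /epar /ipar.
case: (ord2P i) => ->; case: (ord2P k) => ->; case: (ord2P b) => -> /=;
by rewrite ?expr0 ?expr1 ?(scale0r, mul0r, scaler0) ?(add0r, addr0, scale1r,
  oppr0)
   -?scalerAl ?mul1r // ?scaler0 ?(addr0, add0r) // addrC.
Qed.

Lemma tmulRr z w T i b k d : tmul sg T (Rmat A q z w) (i, b, k, d) =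
  colR q z w (fun i b k d => T (i, b, k, d)) i b k d.
Proof.
rewrite /colR tmulE !big_ord2 !RmatE !sgK !if_same /Rcoef /epar /ipar.
case: (ord2P b) => ->; case: (ord2P d) => ->; case: (ord2P k) => -> /=;
by rewrite ?expr0 ?expr1 ?(scale0r, mulr0, scaler0) ?(add0r, addr0, scale1r,
  oppr0)
   -?scalerAr ?mulr1 // ?scaler0 ?(addr0, add0r) // addrC.
Qed.

Lemma rttE a b i j k l :
   rtt sg q X X a b (i, j, k, l) =
     rowR q 1 0 (ltens X (a - 1) b) i j k l
   + rowR q 0 1 (ltens X a (b - 1)) i j k l
   - (colR q 1 0 (rtens X (a - 1) b) i j k l
    + colR q 0 1 (rtens X a (b - 1)) i j k l).
Proof.
rewrite /rtt !(tensDE, tensNE) !tmulRl !tmulRr.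
by rewrite /rowR /colR !(tmul1213 _ sg0 sgX) !(tmul1312 _ sg0 sgX).
Qed.

End RTTeq.

Section YangianRTT.
Variables (K : fieldType) (q : K).
Local Notation Y := (Yq q).

Lemma pinv0 : pinv 0 = 0 :> Free K.
Proof. by apply/malgP => w; rewrite pinvE mcoeff0 mulr0. Qed.

Lemma Free_homog_alg (c : K) : Free_homog false (c%:A : Free K).
Proof.
move=> w; rewrite -mcoeff_neq0 mcoeffZ mcoeff1.
have [->|] := eqVneq w _; last by rewrite mulr0 eqxx.
by rewrite /wpar fm1 big_nil.
Qed.

Lemma pinv_alg (c : K) : pinv c%:A = c%:A :> Free K.
Proof. by rewrite (pinv_homog (@Free_homog_alg c)) expr0 scale1r. Qed.

Lemma Free_homogU (g : gen) : Free_homog (gpar g) (<< fmu g >> : Free K).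
Proof.
move=> w; rewrite msuppU oner_eq0 inE => /eqP ->.
by rewrite /wpar fmuE big_seq1.
Qed.

Lemma pinv_Ss a i j : pinv (Ss K a i j) = (-1) ^+ epar i j *: Ss K a i j.
Proof.
case: a => n /=; last by rewrite pinv0 scaler0.
by rewrite /gs (pinv_homog (@Free_homogU (true, i, j, n))).
Qed.

(** The coefficient of z^a in s_ij(z), in the q-Yangian *)
Definition Sz (a : int) (i j : 'I_2) : Y :=
  if a is Posz n then Ys q i j n else 0.

Lemma Sz_val a i j : Yval (Sz a i j) = Upi q (Ss K a i j).
Proof. by case: a => n //=; rewrite rmorph0. Qed.

Lemma YvalZ (c : K) (y : Y) : Yval (c *: y) = c *: Yval y.
Proof. by []. Qed.

Lemma rttSE a b i j k l :
   rtt (@pinv K) q (@Ss K) (@Ss K) a b (i, j, k, l) =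
     rowR q 1 0 (ltens (@Ss K) (a - 1) b) i j k l
   + rowR q 0 1 (ltens (@Ss K) a (b - 1)) i j k l
   - (colR q 1 0 (rtens (@Ss K) (a - 1) b) i j k l
    + colR q 0 1 (rtens (@Ss K) a (b - 1)) i j k l).
Proof. exact: (rttE q pinv0 pinv_alg pinv_Ss). Qed.

Lemma YvalD (y z : Y) : Yval (y + z) = Yval y + Yval z. Proof. by []. Qed.
Lemma YvalM (y z : Y) : Yval (y * z) = Yval y * Yval z. Proof. by []. Qed.
Lemma Yval_inj (y z : Y) : Yval y = Yval z -> y = z. Proof. exact: val_inj. Qed.
Lemma Upi_scale (c : K) x : Upi q (c *: x) =
  c *: Upi q x. Proof. exact: linearZ. Qed.
Lemma Upi_mul x y : Upi q (x * y) = Upi q x * Upi q y. Proof. exact: rmorphM.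
Qed.

Lemma Yval_ltens a b i j k l :
  Yval (ltens Sz a b i j k l) = Upi q (ltens (@Ss K) a b i j k l).
Proof. by rewrite /ltens YvalZ YvalM !Sz_val Upi_scale Upi_mul. Qed.

Lemma Yval_rtens a b i j k l :
  Yval (rtens Sz a b i j k l) = Upi q (rtens (@Ss K) a b i j k l).
Proof. by rewrite /rtens YvalM !Sz_val Upi_mul. Qed.

Lemma rowR_eq (V : lmodType K) z w (T T' : 'I_2 -> 'I_2 -> 'I_2 -> 'I_2 -> V) i
  b k d :
  (forall i b k d, T i b k d = T' i b k d) ->
  rowR q z w T i b k d = rowR q z w T' i b k d.
Proof. by move=> h; rewrite /rowR !h. Qed.

Lemma colR_eq (V : lmodType K) z w (T T' : 'I_2 -> 'I_2 -> 'I_2 -> 'I_2 -> V) i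
  b k d :
  (forall i b k d, T i b k d = T' i b k d) ->
  colR q z w T i b k d = colR q z w T' i b k d.
Proof. by move=> h; rewrite /colR !h. Qed.

Lemma Yval_rowR z w a b i j k l : Yval (rowR q z w (ltens Sz a b) i j k l) =
  Upi q (rowR q z w (ltens (@Ss K) a b) i j k l).
Proof.
apply: etrans (rowR_lin q YvalD YvalZ _ _ _ _ _ _ _) _.
apply: etrans (rowR_eq _ _ _ _ _ _ (@Yval_ltens a b)) _.
apply: esym; exact: (rowR_lin q (@UpiD K q) Upi_scale).
Qed.

Lemma Yval_colR z w a b i j k l : Yval (colR q z w (rtens Sz a b) i j k l) =
  Upi q (colR q z w (rtens (@Ss K) a b) i j k l).
Proof.
apply: etrans (colR_lin q YvalD YvalZ _ _ _ _ _ _ _) _.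
apply: etrans (colR_eq _ _ _ _ _ _ (@Yval_rtens a b)) _.
apply: esym; exact: (colR_lin q (@UpiD K q) Upi_scale).
Qed.

(** The coefficient of z^a w^b at E_ij (x) E_kl in the RTT relation of the
    q-Yangian *)
Theorem YRTT a b i j k l :
    rowR q 1 0 (ltens Sz (a - 1) b) i j k l + rowR q 0 1 (ltens Sz a (b - 1)) i
      j k l
  = colR q 1 0 (rtens Sz (a - 1) b) i j k l + colR q 0 1 (rtens Sz a (b - 1)) i
    j k l.
Proof.
apply: Yval_inj.
apply: etrans (YvalD _ _) _; apply: etrans (esym (YvalD _ _)).
apply: etrans (f_equal2 +%R (Yval_rowR _ _ _ _ _ _ _ _) (Yval_rowR _ _ _ _ _ _ _
  _)) _.
apply: etrans (f_equal2 +%R (esym (Yval_colR _ _ _ _ _ _ _ _)) (esym (Yval_colR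
  _ _ _ _ _ _ _ _))).
apply: etrans (esym (UpiD _ _ _)) _; apply: etrans (UpiD _ _ _).
apply/Upi_eq; rewrite -rttSE; apply/relideal_gen; exact: relSS.
Qed.

End YangianRTT.

(** * The defining relations of the q-Yangian *)

(** The consequences of the RTT relation for the coefficients [k], [e], [x], [h]
    of s11, s12, s21, s22, each read off from one coefficient of one component
    and solved for its left-hand side. *)
Section Relations.
Variables (K : fieldType) (A : algType K) (q : K).
Variable S : int -> 'I_2 -> 'I_2 -> A.
Hypothesis q0 : q != 0.
Hypothesis SRTT : forall a b i j k l,
    rowR q 1 0 (ltens S (a - 1) b) i j k l + rowR q 0 1 (ltens S a (b - 1)) i j
      k l
  = colR q 1 0 (rtens S (a - 1) b) i j k l + colR q 0 1 (rtens S a (b - 1)) i j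
    k l.
Hypothesis Sneg : forall n i j, S (Negz n) i j = 0.
Hypothesis S21_0 : S 0 ix2 ix1 = 0.
Let g := q - q^-1.
Let k n := S (Posz n) ix1 ix1.
Let e n := S (Posz n) ix1 ix2.
Let x n := S (Posz n) ix2 ix1.
Let h n := S (Posz n) ix2 ix2.

Lemma PoszS1 n : Posz n.+1 - 1 = Posz n. Proof. by rewrite -addn1 PoszD addrK.
Qed.
Lemma Posz01 : Posz 0 - 1 = Negz 0. Proof. by []. Qed.

(** The coefficient of z^a w^b at E_ij (x) E_kl, simplified *)
Tactic Notation "rtt_component" constr(a) constr(b) constr(i) constr(j)
  constr(k) constr(l) :=
  have := SRTT a b i j k l;
  rewrite ?PoszS1 ?Posz01 /rowR /colR /ltens /rtens /epar /ipar /qi /= ?Sneg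
    ?S21_0 ?expr0 ?expr1 ?invrK ?(mul0r, mulr0, scaler0, scale0r, mul1r, scale1r,
      subr0, sub0r, addr0, add0r, scaleN1r, scalerN, scaleNr, opprK, oppr0).

(** Proves [u = v] from an equation [l = r] such that u - v = f (l - r). *)
Tactic Notation "solve_with" uconstr(f) :=
  let E := fresh in move=> E; refine (eq_of_multiple (c := f) E _);
  rewrite /k /e /x /h /g ?Sneg ?S21_0; linear_with K (@leval_eq_alg K A);
    try by field.

Lemma relation_kk a b : k a * k b = k b * k a.
Proof.
have step c d : k c.+1 * k d - k d * k c.+1 =
  q ^+ 2 *: (k c * k d.+1 - k d.+1 * k c).
  rtt_component (Posz c.+1) (Posz d.+1) ix1 ix1 ix1 ix1. solve_with (- q).
have base c : k 0 * k c = k c * k 0.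
  rtt_component (Posz 0) (Posz c.+1) ix1 ix1 ix1 ix1. solve_with (- q).
elim: a b => [|a IH] b; first exact: base.
by apply/eqP; rewrite -subr_eq0 step IH subrr scaler0.
Qed.

Lemma relation_hh a b : h a * h b = h b * h a.
Proof.
have step c d : h c.+1 * h d - h d * h c.+1 =
  q ^- 2 *: (h c * h d.+1 - h d.+1 * h c).
  rtt_component (Posz c.+1) (Posz d.+1) ix2 ix2 ix2 ix2. solve_with (- q^-1).
have base c : h 0 * h c = h c * h 0.
  rtt_component (Posz 0) (Posz c.+1) ix2 ix2 ix2 ix2. solve_with (- q^-1).
elim: a b => [|a IH] b; first exact: base.
by apply/eqP; rewrite -subr_eq0 step IH subrr scaler0.
Qed.

Lemma relation_k0e b : k 0 * e b = q *: (e b * k 0).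
Proof. rtt_component (Posz 0) (Posz b.+1) ix1 ix1 ix1 ix2. solve_with (- q).
Qed.

Lemma relation_ek a b : e b * k a.+1 = e b.+1 * k a + g *: (k b.+1 * e a)
  - q *: (k a * e b.+1) + q^-1 *: (k a.+1 * e b).
Proof. rtt_component (Posz a.+1) (Posz b.+1) ix1 ix1 ix1 ix2. solve_with 1. Qed.

Lemma relation_eh0 a : e a * h 0 = q^-1 *: (h 0 * e a).
Proof. rtt_component (Posz a.+1) (Posz 0) ix1 ix2 ix2 ix2. solve_with 1. Qed.

Lemma relation_eh a b : e a * h b.+1 = e a.+1 * h b + g *: (h a.+1 * e b)
  + q^-1 *: (h b.+1 * e a) - q *: (h b * e a.+1).
Proof. rtt_component (Posz a.+1) (Posz b.+1) ix1 ix2 ix2 ix2. solve_with 1. Qed.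

Lemma relation_k0x b : k 0 * x b = q^-1 *: (x b * k 0).
Proof. rtt_component (Posz 0) (Posz b.+1) ix1 ix1 ix2 ix1. solve_with (-1). Qed.

Lemma relation_kx a b : k a.+1 * x b = k a * x b.+1 + g *: (x a.+1 * k b)
  - q *: (x b.+1 * k a) + q^-1 *: (x b * k a.+1).
Proof. rtt_component (Posz a.+1) (Posz b.+1) ix1 ix1 ix2 ix1. solve_with (-1).
Qed.

Lemma relation_h0x a : h 0 * x a = q^-1 *: (x a * h 0).
Proof. rtt_component (Posz a.+1) (Posz 0) ix2 ix1 ix2 ix2. solve_with (-1). Qed.

Lemma relation_hx a b : h b.+1 * x a = h b * x a.+1 + g *: (x b.+1 * h a)
  + q^-1 *: (x a * h b.+1) - q *: (x a.+1 * h b).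
Proof. rtt_component (Posz a.+1) (Posz b.+1) ix2 ix1 ix2 ix2. solve_with (-1).
Qed.

Lemma relation_e0x b : e 0 * x b = - (x b * e 0) + g *: (h 0 * k b)
  - g *: (h b * k 0).
Proof. rtt_component (Posz 0) (Posz b.+1) ix1 ix2 ix2 ix1. solve_with 1. Qed.

Lemma relation_ex a b : e a.+1 * x b = - (x b * e a.+1) + e a * x b.+1
  + x b.+1 * e a + g *: (h a.+1 * k b) - g *: (h b * k a.+1).
Proof. rtt_component (Posz a.+1) (Posz b.+1) ix1 ix2 ix2 ix1. solve_with 1. Qed.

Lemma relation_k0h b : k 0 * h b = h b * k 0.
Proof. rtt_component (Posz 0) (Posz b.+1) ix1 ix1 ix2 ix2. solve_with (-1). Qed.

Lemma relation_kh a b : k a.+1 * h b = h b * k a.+1 + k a * h b.+1 - h b.+1 * k a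
  - g *: (x a.+1 * e b) + g *: (x b.+1 * e a).
Proof. rtt_component (Posz a.+1) (Posz b.+1) ix1 ix1 ix2 ix2. solve_with (-1).
Qed.

Lemma relation_xx c a : x c * x a.+1 + q ^+ 2 *: (x a.+1 * x c) =
  x a * x c.+1 + q ^+ 2 *: (x c.+1 * x a).
Proof. rtt_component (Posz a.+1) (Posz c.+1) ix2 ix1 ix2 ix1. solve_with q. Qed.

End Relations.

(** * Finitely spanned modules and eigenvectors *)

Section Span.
Variables (K : fieldType) (A : algType K) (V : lmodType A).
Implicit Types (c d : K) (u v w : V) (y : A).

(** Finite dimension over [K], which acts on [V] through [c%:A]. *)
Definition finspan : Prop :=
  exists n (b : 'I_n -> V), forall v : V, exists c : 'I_n -> K,
    v = \sum_(i < n) (c i)%:A *: b i.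

Lemma kscaleA c d v : c%:A *: (d%:A *: v) = (c * d)%:A *: v.
Proof. by rewrite scalerA mulr_algl scalerA. Qed.

Lemma kscaleC y c v : y *: (c%:A *: v) = c%:A *: (y *: v).
Proof. by rewrite !scalerA mulr_algl mulr_algr. Qed.

Lemma kscaleE y c v : (c *: y) *: v = c%:A *: (y *: v).
Proof. by rewrite scalerA mulr_algl. Qed.

Lemma kscaleN c v : (- c)%:A *: v = - (c%:A *: v).
Proof. by rewrite scaleNr scaleNr. Qed.

Lemma kscaleDl c d v : (c + d)%:A *: v = c%:A *: v + d%:A *: v.
Proof. by rewrite scalerDl scalerDl. Qed.

Lemma kscale_eq0 c v : c != 0 -> c%:A *: v = 0 -> v = 0.
Proof.
move=> c0 cv; rewrite -[v]scale1r -(scale1r (1 : A)) -(mulVf c0) -kscaleA cv.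
by rewrite scaler0.
Qed.

Lemma ksuml I r (P : pred I) (F : I -> K) v :
  (\sum_(i <- r | P i) F i)%:A *: v = \sum_(i <- r | P i) (F i)%:A *: v.
Proof. by rewrite scaler_suml scaler_suml. Qed.

(** Subspaces of [V] over [K] *)
Definition kclosed (P : V -> Prop) : Prop :=
  [/\ P 0, forall u v, P u -> P v -> P (u + v)
    & forall c v, P v -> P (c%:A *: v)].

Lemma kclosed_sum P I r (Q : pred I) (F : I -> V) : kclosed P ->
  (forall i, Q i -> P (F i)) -> P (\sum_(i <- r | Q i) F i).
Proof. by case=> P0 PD _ PF; elim/big_ind: _. Qed.

Lemma kclosedN P v : kclosed P -> P v -> P (- v).
Proof. by case=> _ _ PZ /(PZ (-1)); rewrite kscaleN !scale1r. Qed.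

(** The linear span of the vectors satisfying [B] *)
Inductive kspan (B : V -> Prop) : V -> Prop :=
| kspan_in v of B v : kspan B v
| kspan0 : kspan B 0
| kspanD u v of kspan B u & kspan B v : kspan B (u + v)
| kspanZ c v of kspan B v : kspan B (c%:A *: v).

Lemma kspan_closed B : kclosed (kspan B).
Proof. by split; [exact: kspan0|exact: kspanD|exact: kspanZ]. Qed.

Lemma kspan_min B P : kclosed P -> (forall v, B v -> P v) ->
  forall v, kspan B v -> P v.
Proof.
case=> P0 PD PZ BP v; elim=> {v} [v /BP //|//|u v _ Pu _ Pv|c v _ Pv].
- exact: PD.
- exact: PZ.
Qed.

Lemma kspan_act B C y : (forall v, B v -> kspan C (y *: v)) ->
  forall v, kspan B v -> kspan C (y *: v).
Proof.
move=> yB; apply: kspan_min => //; split=> [|u v yu yv|c v yv].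
- by rewrite scaler0; apply: kspan0.
- by rewrite scalerDr; apply: kspanD.
- by rewrite kscaleC; apply: kspanZ.
Qed.

Lemma kspan_fin (B : V -> Prop) n (b : 'I_n -> V) :
  (forall v, B v -> exists i, v = b i) -> (forall v, kspan B v) -> finspan.
Proof.
move=> Bb BV; exists n, b => v; move: v (BV v); apply: kspan_min.
  split=> [|u w [c ->] [d ->]|a w [c ->]].
  - by exists (fun=> 0); rewrite big1 // => i _; rewrite !scale0r.
  - exists (fun i => c i + d i); rewrite -big_split /=.
    by apply: eq_bigr => i _; rewrite kscaleDl.
  - exists (fun i => a * c i); rewrite scaler_sumr.
    by apply: eq_bigr => i _; rewrite kscaleA.
move=> w /Bb [i ->]; exists (fun j => (j == i)%:R).
rewrite (bigD1 i) //= eqxx !scale1r big1 ?addr0 // => j /negPf ->.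
by rewrite !scale0r.
Qed.

(** The number [n] of vectors that suffices is independent of the vectors. *)
Lemma finspan_dep : finspan -> exists n, forall w : nat -> V,
  exists2 c : nat -> K, exists2 i, (i < n)%N & c i != 0 &
  \sum_(i < n) (c i)%:A *: w i = 0.
Proof.
case=> n [b bP]; exists n.+1 => w.
have [M MP] := choice (fun i => bP (w i)).
pose N : 'M[K]_(n.+1, n) := \matrix_(i, j) M i j.
have : kermx N != 0.
  rewrite kermx_eq0 /row_free neq_ltn ltnS.
  by apply/orP; left; apply: rank_leq_col.
case/rowV0Pn => u /sub_kermxP uN /rV0Pn [i ui].
exists (fun i => if insub i is Some j then u 0 j else 0).
  by exists i => //; rewrite insubT // => ii; rewrite (_ : Sub _ _ = i) //;
    apply: val_inj.
transitivity (\sum_(i < n.+1) \sum_(j < n) (u 0 i * N i j)%:A *: b j).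
  apply: eq_bigr => j _; rewrite valK {1}MP scaler_sumr.
  by apply: eq_bigr => l _; rewrite kscaleA mxE.
rewrite exchange_big big1 //= => j _; rewrite -ksuml.
have := congr1 (fun X : 'rV_n => X 0 j) uN; rewrite !mxE => ->.
by rewrite !scale0r.
Qed.

(** An eigenvector of [y] is one of every polynomial in [y]. *)
Lemma horner_act (y : A) (p : {poly K}) (c : K) v :
  y *: v = c%:A *: v -> horner_alg y p *: v = p.[c]%:A *: v.
Proof.
move=> yv; elim/poly_ind: p => [|p d IH].
  by rewrite rmorph0 horner0 !scale0r.
rewrite rmorphD rmorphM /= horner_algX horner_algC hornerMXaddC.
by rewrite kscaleDl scalerDl -scalerA yv kscaleC IH kscaleA mulrC.
Qed.

Lemma horner_alg_act (y : A) (p r : {poly K}) v :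
  horner_alg y p *: (horner_alg y r *: v) = horner_alg y (p * r) *: v.
Proof. by rewrite scalerA rmorphM. Qed.

(** Eigenvectors for distinct eigenvalues are independent; hence a
    finitely spanned module has no infinite family of them. *)
Lemma eigen_finite (y : A) (mu : nat -> K) (w : nat -> V) : finspan ->
  injective mu -> (forall i, y *: w i = (mu i)%:A *: w i) ->
  exists i, w i = 0.
Proof.
move=> /finspan_dep [n dep] mu_inj yw.
have [c [i lt_in ci] cw] := dep w.
(* [p] vanishes at all eigenvalues but the [i]-th. *)
pose p := \prod_(j < n | val j != i) ('X - (mu j)%:P).
exists i; have := congr1 (fun v => horner_alg y p *: v) cw.
rewrite /= scaler0 scaler_sumr (bigD1 (Ordinal lt_in)) //= big1 ?addr0.
  rewrite kscaleC (horner_act _ (yw i)) kscaleA; apply: kscale_eq0.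
  rewrite mulf_neq0 // horner_prod; apply/prodf_neq0 => j ji.
  rewrite hornerXsubC subr_eq0; apply: contraNneq ji => /mu_inj -> //.
move=> j ji; rewrite kscaleC (horner_act _ (yw j)) kscaleA.
rewrite /p horner_prod (bigD1 j) //= hornerXsubC subrr mul0r mulr0.
by rewrite !scale0r.
Qed.

End Span.

Section Eigenvectors.
Variables (K : closedFieldType) (A : algType K) (V : lmodType A).
Hypothesis fV : finspan V.
Implicit Types (P : V -> Prop).

(** A non-zero subspace stable under [y] contains an eigenvector of [y]. *)
Lemma eigenvector (y : A) P v : kclosed P -> (forall u, P u -> P (y *: u)) ->
  P v -> v != 0 -> exists c : K, exists u, [/\ P u, u != 0 & y *: u =
    c%:A *: u].
Proof.
move=> kP yP Pv v0; have [n dep] := finspan_dep fV.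
have [c [i ltin ci] cv] := dep (fun i => y ^+ i *: v).
have hP (p : {poly K}) u : P u -> P (horner_alg y p *: u).
  elim/poly_ind: p u => [|p d IH] u Pu; first by rewrite rmorph0 scale0r;
    case: kP.
  rewrite rmorphD rmorphM /= horner_algX horner_algC scalerDl -scalerA.
  by case: kP => _ PD PZ; apply: PD; [apply/IH/yP|apply: PZ].
have [p p0 pv] : exists2 p : {poly K}, p != 0 & horner_alg y p *: v = 0.
  exists (\poly_(j < n) c j).
    by apply: contraNneq ci => p0; rewrite -[c i]/(if true then c i else 0)
      -ltin -coef_poly p0 coef0.
  rewrite poly_def rmorph_sum /= scaler_suml -[RHS]cv; apply: eq_bigr => j _.
  by rewrite -mul_polyC rmorphM rmorphXn /= horner_algC horner_algX scalerA.
(* Divide [p] by linear factors as long as the quotient kills [v]. *)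
have [m] := ubnP (size p); elim: m p p0 pv => // m IH p p0 pv szp.
have [sz1|sz1] := eqVneq (size p) 1%N.
  have /size_poly1P [d d0 pd] : size p == 1%N by rewrite sz1.
  by case/eqP: v0; move: pv; rewrite pd horner_algC => /(kscale_eq0 d0).
have /closed_rootP [a] := sz1.
case/factor_theorem => r pr.
have r0 : r != 0 by apply: contraNneq p0 => r0; rewrite pr r0 mul0r.
have [rv|rv] := eqVneq (horner_alg y r *: v) 0.
  apply: (IH r) => //; move: szp; rewrite pr size_Mmonic ?monicXsubC //.
  by rewrite size_XsubC addn2.
exists a, (horner_alg y r *: v); split=> //; first exact: hP.
apply/eqP; rewrite -subr_eq0; move: pv; rewrite pr mulrC -horner_alg_act.
by rewrite rmorphB /= horner_algX horner_algC scalerBl => ->.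
Qed.

(** Operators that commute on a non-zero subspace which they preserve have a
    common eigenvector in it. *)
Lemma commuting_eigenvector (I : Type) (y : I -> A) P v : kclosed P ->
  (forall i u, P u -> P (y i *: u)) ->
  (forall i j u, P u -> y i *: (y j *: u) = y j *: (y i *: u)) ->
  P v -> v != 0 ->
  exists u, [/\ P u, u != 0 & forall i, exists c : K, y i *: u = c%:A *: u].
Proof.
move=> kP yP yC Pv v0; have [n dep] := finspan_dep fV.
pose concl P := exists u, [/\ P u, u != 0 & forall i, exists c :
  K, y i *: u = c%:A *: u].
rewrite -/(concl P).
(* Without a common eigenvector, passing to an eigenspace of an operator which
  is
   not scalar on [P] gives a proper stable subspace; iterating [n] times yields
   [n] independent vectors. *)
suff [//|[w [_ wind]]] : concl P \/ exists w : nat -> V, (forall i, P (w i)) /\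
    forall c : nat -> K, \sum_(i < n) (c i)%:A *: w i = 0 ->
    forall i, (i < n)%N -> c i = 0.
  have [c [i lt_in ci] cw] := dep w.
  by rewrite (wind c cw i lt_in) eqxx in ci.
elim: n {dep} P kP yP yC v Pv v0 => [|n IH] P kP yP yC v Pv v0.
  by right; exists (fun=> 0); split => // _; case: kP.
have [[i [a [u [Pu u0 yu [t Pt yt]]]]]|noprop] := pselect (exists i (a : K) u,
    [/\ P u, u != 0, y i *: u = a%:A *: u & exists2 t,
      P t & y i *: t <> a%:A *: t]).
  pose Q w := P w /\ y i *: w = a%:A *: w.
  have kQ : kclosed Q.
    case: kP => P0 PD PZ; split.
    - by split=> //; rewrite !scaler0.
    - move=> w1 w2 [Pw1 e1] [Pw2 e2]; split; first exact: PD.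
      by rewrite !scalerDr e1 e2.
    - by move=> c w [Pw e]; split; [exact: PZ|rewrite kscaleC e !kscaleA mulrC].
  have [j w [Pw e]|j l w [Pw _]|||[w [Pw w0 ew]]|[w [Qw wind]]] := IH Q kQ _ _
    u.
  - by split; [exact: yP|rewrite yC // e kscaleC].
  - exact: yC.
  - by [].
  - exact: u0.
  - by left; exists w; split=> //; case: Pw.
  right; exists (fun i => if i is j.+1 then w j else t); split.
    by case=> // j; case: (Qw j).
  move=> c; rewrite big_ord_recl /= => cw.
  have Qsum : Q (\sum_(j < n) (c j.+1)%:A *: w j).
    by apply: kclosed_sum => // j _; case: kQ => _ _; apply.
  have c0 : c 0%N = 0.
    apply/eqP; apply: contrapT => /negP c0; case: yt.
    have [_ _ QZ] := kQ.
    suff [//] : Q t.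
    have -> : t = (- (c 0%N)^-1)%:A *: \sum_(j < n) (c j.+1)%:A *: w j.
      rewrite (_ : \sum_(j < n) _ = - ((c 0%N)%:A *: t)).
        by rewrite scalerN kscaleN opprK kscaleA mulVf // !scale1r.
      by apply/eqP; rewrite -addr_eq0 addrC; apply/eqP.
    exact: QZ.
  case=> // j jn; apply: (wind (fun j => c j.+1)) => //.
  by move: cw; rewrite c0 !scale0r add0r.
left; exists v; split=> // i.
have [a [u [Pu u0 yu]]] := eigenvector kP (yP i) Pv v0.
exists a; apply: contrapT => yv; apply: noprop.
by exists i, a, u; split=> //; exists v.
Qed.

End Eigenvectors.

(** * Lowering operators and singular vectors *)

(** The relations of the coefficients [k], [e], [x], [h] of s11, s12, s21,
  s22 and
    of the inverses [ki], [hi] of [k 0] and [h 0] that the argument uses *)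
Record gl11_relations (K : fieldType) (A : algType K) (q : K)
  (k e x h : nat -> A) (ki hi : A) : Prop := Gl11Relations {
  gl_x0 : x 0%N = 0;
  gl_kVk : ki * k 0%N = 1;
  gl_kkV : k 0%N * ki = 1;
  gl_hVh : hi * h 0%N = 1;
  gl_hhV : h 0%N * hi = 1;
  gl_kk : forall a b, k a * k b = k b * k a;
  gl_hh : forall a b, h a * h b = h b * h a;
  gl_ke0 : forall b, k 0%N * e b = q *: (e b * k 0%N);
  gl_ek : forall a b, e b * k a.+1 = e b.+1 * k a + (q - q^-1) *: (k b.+1 * e a)
    - q *: (k a * e b.+1) + q^-1 *: (k a.+1 * e b);
  gl_eh0 : forall a, e a * h 0%N = q^-1 *: (h 0%N * e a);
  gl_eh : forall a b, e a * h b.+1 = e a.+1 * h b + (q - q^-1) *: (h a.+1 * e b)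
    + q^-1 *: (h b.+1 * e a) - q *: (h b * e a.+1);
  gl_kx0 : forall b, k 0%N * x b = q^-1 *: (x b * k 0%N);
  gl_kx : forall a b, k a.+1 * x b = k a * x b.+1 + (q - q^-1) *: (x a.+1 * k b)
    - q *: (x b.+1 * k a) + q^-1 *: (x b * k a.+1);
  gl_hx0 : forall a, h 0%N * x a = q^-1 *: (x a * h 0%N);
  gl_hx : forall a b, h b.+1 * x a = h b * x a.+1 + (q - q^-1) *: (x b.+1 * h a)
    + q^-1 *: (x a * h b.+1) - q *: (x a.+1 * h b);
  gl_ex0 : forall b, e 0%N * x b = - (x b * e 0%N)
    + (q - q^-1) *: (h 0%N * k b) - (q - q^-1) *: (h b * k 0%N);
  gl_ex : forall a b, e a.+1 * x b = - (x b * e a.+1) + e a * x b.+1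
    + x b.+1 * e a + (q - q^-1) *: (h a.+1 * k b) - (q - q^-1) *: (h b * k a.+1);
  gl_kh0 : forall b, k 0%N * h b = h b * k 0%N;
  gl_kh : forall a b, k a.+1 * h b = h b * k a.+1 + k a * h b.+1 - h b.+1 * k a
    - (q - q^-1) *: (x a.+1 * e b) + (q - q^-1) *: (x b.+1 * e a);
  gl_xx : forall c a, x c * x a.+1 + q ^+ 2 *: (x a.+1 * x c) =
    x a * x c.+1 + q ^+ 2 *: (x c.+1 * x a)
}.

Section Modules.
Variables (K : fieldType) (A : algType K) (q : K).
Variables (k e x h : nat -> A) (ki hi : A).
Hypothesis q0 : q != 0.
Hypothesis rel : gl11_relations q k e x h ki hi.
Variable V : lmodType A.
Implicit Types (u v w : V) (P : V -> Prop).

Notation g := (q - q^-1).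

Let actE (a b : A) : a = b -> forall v, a *: v = b *: v.
Proof. by move=> ->. Qed.

(** Stability under the diagonal generators and their inverses *)
Definition kstable P : Prop :=
  [/\ forall n v, P v -> P (k n *: v), forall n v, P v -> P (h n *: v),
      forall v, P v -> P (ki *: v) & forall v, P v -> P (hi *: v)].

Definition singular v : Prop := forall n, e n *: v = 0.

Lemma singular_closed : kclosed singular.
Proof.
split=> [n|u v su sv n|c v sv n]; first by rewrite scaler0.
- by rewrite scalerDr su sv addr0.
- by rewrite kscaleC sv scaler0.
Qed.

Lemma kscaleM (c : K) (a b : A) v : (c *: (a * b)) *: v =
  c%:A *: (a *: (b *: v)).
Proof. by rewrite kscaleE scalerA. Qed.

Definition actS := (scalerDl, scaleNr, kscaleM, =^~ scalerA).

Lemma comm_inv (y z zi : A) (c : K) : zi * z = 1 -> z * zi = 1 ->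
  y * z = c *: (z * y) -> zi * y = c *: (y * zi).
Proof.
move=> zVz zzV yz.
transitivity (zi * (y * z) * zi); first by rewrite -!mulrA zzV mulr1.
by rewrite yz -scalerAr -scalerAl !mulrA zVz mul1r.
Qed.

Lemma qsym (y z : A) : z * y = q *: (y * z) -> y * z = q^-1 *: (z * y).
Proof. by move=> ->; rewrite scalerA mulVf // scale1r. Qed.

Lemma qVsym (y z : A) : z * y = q^-1 *: (y * z) -> y * z = q *: (z * y).
Proof. by move=> ->; rewrite scalerA mulfV // scale1r. Qed.

Lemma e_ki b : e b * ki = q *: (ki * e b).
Proof.
apply: qVsym; apply: (comm_inv (gl_kVk rel) (gl_kkV rel)).
by apply: qsym; exact: (gl_ke0 rel).
Qed.

Lemma e_hi b : e b * hi = q *: (hi * e b).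
Proof.
apply: qVsym; apply: (comm_inv (gl_hVh rel) (gl_hhV rel)).
exact: (gl_eh0 rel).
Qed.

Lemma ki_x b : ki * x b = q *: (x b * ki).
Proof.
apply: (comm_inv (gl_kVk rel) (gl_kkV rel)).
by apply: qVsym; exact: (gl_kx0 rel).
Qed.

Lemma hi_x b : hi * x b = q *: (x b * hi).
Proof.
apply: (comm_inv (gl_hVh rel) (gl_hhV rel)).
by apply: qVsym; exact: (gl_hx0 rel).
Qed.

Lemma singular_stable : kstable singular.
Proof.
split.
- elim=> [|n IH] v sv b.
    rewrite scalerA (qsym (gl_ke0 rel b)) kscaleE -scalerA sv.
    by rewrite !scaler0.
  by rewrite scalerA (gl_ek rel) !actS !sv IH // !scaler0 oppr0 !addr0.
- elim=> [|n IH] v sv b.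
    by rewrite scalerA (gl_eh0 rel) kscaleE -scalerA sv !scaler0.
  by rewrite scalerA (gl_eh rel) !actS !sv IH // !scaler0 oppr0 !addr0.
- by move=> v sv b; rewrite scalerA e_ki kscaleE -scalerA sv !scaler0.
- by move=> v sv b; rewrite scalerA e_hi kscaleE -scalerA sv !scaler0.
Qed.

(** [k a] and [h b] commute only up to terms ending in some [e n]. *)
Lemma singular_kh a b v : singular v -> k a *: (h b *: v) = h b *: (k a *: v).
Proof.
move=> sv; elim: a b => [|a IH] b; first by rewrite !scalerA (gl_kh0 rel).
rewrite scalerA (gl_kh rel) !actS !sv !scaler0 oppr0 !addr0 -IH.
by rewrite subr0 addrK.
Qed.

(** Words in the lowering operators applied to a vector. *)
Definition xword (s : seq nat) v : V := foldr (fun n u => x n *: u) v s.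

(** For [W] as in [xspan_stable] and [xspan_e], the submodule generated by it *)
Definition xspan (W : V -> Prop) : V -> Prop :=
  kspan (fun u => exists s w, W w /\ u = xword s w).

Lemma xspan_in W w : W w -> xspan W w.
Proof. by move=> Ww; apply: kspan_in; exists [::], w. Qed.

Lemma xspan_x W n v : xspan W v -> xspan W (x n *: v).
Proof.
apply: kspan_act => {v} _ [s [w [Ww ->]]].
by apply: kspan_in; exists (n :: s), w.
Qed.

Lemma xspan_closed W : kclosed (xspan W).
Proof. exact: kspan_closed. Qed.

Section Stable.
Variable W : V -> Prop.
Hypothesis Wst : kstable W.
Hypothesis Wsing : forall w, W w -> singular w.

Let XD := let: And3 _ XD _ := xspan_closed W in XD.
Let XZ := let: And3 _ _ XZ := xspan_closed W in XZ.
Let XN v : xspan W v -> xspan W (- v).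
Proof. by apply: kclosedN; apply: xspan_closed. Qed.

(** Moving a diagonal generator across [x b] produces words starting with some
    lowering operator and a diagonal generator of smaller index, hence the
    nested inductions. *)
Lemma xspan_stable : kstable (xspan W).
Proof.
split.
- move=> n v; apply: kspan_act => {v} _ [s [w [Ww ->]]].
  elim: s n => [|b s IH] n /=; first by apply: xspan_in; case: Wst => + _ _ _;
    apply.
  elim: n b => [|n IHn] b.
    by rewrite scalerA (gl_kx0 rel) !actS; apply/XZ/xspan_x/IH.
  rewrite scalerA (gl_kx rel) !actS.
  repeat first [apply: XD | apply: XN | apply: XZ];
    by [apply/xspan_x/IH|apply: IHn].
- move=> n v; apply: kspan_act => {v} _ [s [w [Ww ->]]].
  elim: s n => [|b s IH] n /=; first by apply: xspan_in; case: Wst => _ + _ _;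
    apply.
  elim: n b => [|n IHn] b.
    by rewrite scalerA (gl_hx0 rel) !actS; apply/XZ/xspan_x/IH.
  rewrite scalerA (gl_hx rel) !actS.
  repeat first [apply: XD | apply: XN | apply: XZ];
    by [apply/xspan_x/IH|apply: IHn].
- move=> v; apply: kspan_act => {v} _ [s [w [Ww ->]]].
  elim: s => [|b s IH] /=; first by apply: xspan_in; case: Wst => _ _ + _;
    apply.
  by rewrite scalerA ki_x !actS; apply/XZ/xspan_x.
- move=> v; apply: kspan_act => {v} _ [s [w [Ww ->]]].
  elim: s => [|b s IH] /=; first by apply: xspan_in; case: Wst => _ _ _; apply.
  by rewrite scalerA hi_x !actS; apply/XZ/xspan_x.
Qed.

Lemma xspan_e n v : xspan W v -> xspan W (e n *: v).
Proof.
have [Xk Xh _ _] := xspan_stable.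
apply: kspan_act => {v} _ [s [w [Ww ->]]].
elim: s n => [|b s IH] n /=; first by rewrite Wsing //; apply: kspan0.
have Xw : xspan W (xword s w) by apply: kspan_in; exists s, w.
elim: n b => [|n IHn] b.
  rewrite scalerA (gl_ex0 rel) !actS.
  repeat first [apply: XD | apply: XN | apply: XZ];
    by [apply/xspan_x/IH|apply/Xh/Xk|apply/Xk/Xh].
rewrite scalerA (gl_ex rel) !actS.
repeat first [apply: XD | apply: XN | apply: XZ];
  by [apply/xspan_x/IH|apply/Xh/Xk|apply/Xk/Xh|apply: IHn].
Qed.

End Stable.

Section Straighten.
Hypothesis q2 : 1 + q ^+ 2 != 0.

(** The relation [gl_xx] says that H(c, a) = x_c x_a + q^2 x_a x_c satisfies
    H(c, a + 1) = H(a, c + 1). It expresses x_a x_b through x_b x_a and through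
    products involving the smaller index b - 1, and x_0 = 0 starts the
    induction. *)
Lemma x_straighten a b u : (b <= a)%N ->
  kspan (fun w => exists c d, [/\ (c <= b)%N, (c < d)%N, (c + d = a + b)%N
                               & w = x c *: (x d *: u)]) (x a *: (x b *: u)).
Proof.
elim: b a => [|b IH] a ba; first by rewrite (gl_x0 rel) scale0r scaler0;
  apply: kspan0.
set B := (fun w => _).
have [_ BD BZ] := kspan_closed B.
have BN w : kspan B w -> kspan B (- w) by apply: kclosedN; apply: kspan_closed.
have E : x a *: (x b.+1 *: u) + (q ^+ 2)%:A *: (x b.+1 *: (x a *: u)) =
         x b *: (x a.+1 *: u) + (q ^+ 2)%:A *: (x a.+1 *: (x b *: u)).
  have := actE (gl_xx rel b a) u; rewrite !actS => ->.
  by rewrite /=.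
have {IH} IH : kspan B (x a.+1 *: (x b *: u)).
  apply: (kspan_min (kspan_closed B)) (IH a.+1 _); last by lia.
  move=> w [c [d [cb cd cdab ->]]]; apply: kspan_in.
  by exists c, d; split=> //; lia.
have Bb : kspan B (x b *: (x a.+1 *: u)).
  by apply: kspan_in; exists b, a.+1; split=> //; lia.
(* If a = b + 1, the square of x_a occurs on both sides. *)
have /predU1P [ab|lt_ba] : (a == b.+1) || (b.+1 < a)%N by lia.
  have -> : x a *: (x b.+1 *: u) = ((1 + q ^+ 2)^-1)%:A *:
      (x b *: (x a.+1 *: u) + (q ^+ 2)%:A *: (x a.+1 *: (x b *: u))).
    by rewrite -E ab; linear_with K (@leval_eq_mod K A V); field.
  exact: BZ _ _ (BD _ _ Bb (BZ _ _ IH)).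
have -> : x a *: (x b.+1 *: u) = x b *: (x a.+1 *: u)
    + (q ^+ 2)%:A *: (x a.+1 *: (x b *: u))
    - (q ^+ 2)%:A *: (x b.+1 *: (x a *: u)) by rewrite -E addrK.
apply: (BD _ _ (BD _ _ Bb (BZ _ _ IH))); apply: BN; apply: BZ.
by apply: kspan_in; exists b.+1, a; split=> //; lia.
Qed.

(** The words with strictly increasing letters and given length and sum. *)
Definition strict_word v (L m : nat) u : Prop := exists s : seq nat,
  [/\ sorted ltn s, size s = L, sumn s = m & u = xword s v].

(** The product x_a x_b straightens into products x_c x_d with c < a, so that
    the first letter decreases once the tail has been straightened. *)
Lemma x_strict v L m a u : strict_word v L m u ->
  kspan (strict_word v L.+1 (a + m)) (x a *: u).
Proof.
elim/ltn_ind: L m a u => L IHL m a.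
elim/ltn_ind: a m => a IHa m u [s [s_lt sL sm ->]].
case: s s_lt sL sm => [|b s] s_lt sL sm.
  apply: kspan_in; exists [:: a]; split=> //=; first by rewrite -sL.
  by rewrite -sm addn0.
have [ab|ba] := ltnP a b.
  by apply: kspan_in; exists [:: a, b & s]; split=> //=; rewrite ?ab -?sL -?sm.
apply: kspan_min (x_straighten (xword s v) ba); first exact: kspan_closed.
move=> w [c [d [cb cd cdab ->]]] /=.
have LL : (size s < L)%N by rewrite -sL.
have {}IHL : kspan (strict_word v (size s).+1 (d + sumn s)) (x d *: xword s v).
  by apply: (IHL _ LL); exists s; split=> //; apply: path_sorted s_lt.
rewrite (_ : (size s).+1 = L) // in IHL.
have ca : (c < a)%N by lia.
move: (x d *: xword s v) IHL; apply: kspan_act => t Bt.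
have := IHa c ca _ t Bt.
by rewrite (_ : (c + (d + sumn s) = a + m)%N) // -sm /=; lia.
Qed.

Lemma xword_strict v s : kspan (strict_word v (size s) (sumn s)) (xword s v).
Proof.
elim: s => [|a s IH] /=; first by apply: kspan_in; exists [::].
by move: (xword s v) IH; apply: kspan_act => u; apply: x_strict.
Qed.

Section Reduce.
Variables (v : V) (D : nat).
Hypothesis xv_red : forall n, (D <= n)%N ->
  kspan (fun u => exists2 m, (m < n)%N & u = x m *: v) (x n *: v).

(** The words with strictly increasing letters below [D] *)
Definition good_word u : Prop := exists s : seq nat,
  [/\ sorted ltn s, all (gtn D) s & u = xword s v].

Lemma xword_rcons s n u : xword (rcons s n) u = xword s (x n *: u).
Proof. by rewrite /xword foldr_rcons. Qed.

Lemma xword_good s : kspan good_word (xword s v).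
Proof.
have [m] := ubnP (sumn s); elim: m s => // m IH s sm.
apply: (kspan_min (kspan_closed _)) (xword_strict v s) => _ [t [t_lt _ ts ->]].
case: (lastP t) t_lt ts => [|{}t n] t_lt ts; first by apply: kspan_in;
  exists [::].
have [Dn|nD] := leqP D n; last first.
  apply: kspan_in; exists (rcons t n); split=> //.
  move: t_lt; rewrite -rev_sorted rev_rcons /= =>
    /(order_path_min (rev_trans ltn_trans)).
  rewrite all_rev all_rcons /= nD => /allP H; apply/allP => i /H /= in_;
    exact: ltn_trans in_ nD.
rewrite xword_rcons; move: (xv_red Dn).
have : forall w, (exists2 m0, (m0 < n)%N & w =
  x m0 *: v) -> kspan good_word (xword t w).
  move=> w [l ln ->]; rewrite -xword_rcons; apply: IH.
  by move: ts sm; rewrite !sumn_rcons; lia.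
move: (x n *: v) => w H.
have [G0 GD GZ] := kspan_closed good_word.
suff cl : kclosed (fun u => kspan good_word (xword t u)) by move: w;
  apply: kspan_min.
have tD u1 u2 : xword t (u1 + u2) = xword t u1 + xword t u2.
  by elim: (t) => //= i t' ->; rewrite scalerDr.
have tZ c u1 : xword t (c%:A *: u1) = c%:A *: xword t u1.
  by elim: (t) => //= i t' ->; rewrite kscaleC.
split=> [|u1 u2 h1 h2|c u1 h1].
- by have -> : xword t 0 = 0 by elim: (t) => //= i t' ->; rewrite scaler0.
- by rewrite tD; apply: GD.
- by rewrite tZ; apply: GZ.
Qed.

(** Such words are indexed by the subsets of [0, D). *)
Lemma good_word_fin : (forall u, kspan good_word u) -> finspan V.
Proof.
move=> allV; pose b (i : 'I_#|{set 'I_D}|) := xword [seq val j | j <- enum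
  (enum_val i)] v.
apply: (kspan_fin (b := b)) allV => _ [s [s_lt sD ->]].
exists (enum_rank [set i : 'I_D | val i \in s]); rewrite /b enum_rankK;
  congr xword.
apply: (irr_sorted_eq ltn_trans ltnn) => //.
  rewrite sorted_map; apply: sorted_filter; first by move=> ???;
    apply: ltn_trans.
  by have := iota_ltn_sorted 0 D; rewrite -val_enum_ord sorted_map enumT.
move=> n; apply/idP/mapP => [ns|[j]].
  have nD := allP sD n ns; exists (Ordinal nD) => //.
  by rewrite mem_enum inE.
by rewrite mem_enum inE => ? ->.
Qed.

End Reduce.
End Straighten.
End Modules.

(** * Weights, gradings and highest weight vectors *)

Section Weights.
Variables (K : fieldType) (A : algType K) (q : K).
Variables (k e x h : nat -> A) (ki hi : A).
Hypothesis q0 : q != 0.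
Hypothesis q_not_root : forall n : nat, (0 < n)%N -> q ^+ n != 1.
Hypothesis rel : gl11_relations q k e x h ki hi.
Variable V : lmodType A.
Implicit Types (u v w : V) (P : V -> Prop).

(** The singular vectors of weight [mu], the eigenvalue of [k 0]. *)
Definition singular_weight (mu : K) v : Prop :=
  singular e v /\ k 0%N *: v = mu%:A *: v.

Lemma singular_weight_stable mu : kstable k h ki hi (singular_weight mu).
Proof.
have [Sk Sh Ski Shi] := singular_stable q0 rel V.
split=> [n v|n v|v|v] [sv ev].
- by split; [exact: Sk|rewrite scalerA (gl_kk rel) -scalerA ev kscaleC].
- by split; [exact: Sh|rewrite (singular_kh rel) // ev kscaleC].
- split; first exact: Ski.
  by rewrite scalerA (gl_kkV rel) -kscaleC -ev scalerA (gl_kVk rel).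
- have sw := Shi _ sv; split=> //.
  rewrite -[LHS]scale1r -[X in X *: _ = _](gl_hVh rel) -[LHS]scalerA
    -(singular_kh rel 0 0) //.
  by rewrite (scalerA (h 0%N)) (gl_hhV rel) scale1r ev kscaleC.
Qed.

Lemma xword_weight mu s w : singular_weight mu w ->
  k 0%N *: xword x s w = (mu * q ^- size s)%:A *: xword x s w.
Proof.
move=> [_ ew]; elim: s => [|b s IH] /=; first by rewrite expr0 invr1 mulr1.
rewrite scalerA (gl_kx0 rel) kscaleM IH kscaleC kscaleA.
by congr (_%:A *: _); rewrite exprS invfM mulrCA.
Qed.

(** The submodule generated by the singular vectors of weight [mu] contains
    no vector of weight [mu * q]: its weights are [mu * q ^- n]. *)
Lemma xspan_weight mu v : mu != 0 -> xspan x (singular_weight mu) v ->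
  k 0%N *: v = (mu * q)%:A *: v -> v = 0.
Proof.
move=> mu0 Xv ev.
suff [p pmu pv] : exists2 p : {poly K}, p.[mu * q] != 0 &
    horner_alg (k 0%N) p *: v = 0.
  by apply: (kscale_eq0 pmu); rewrite -(horner_act p ev).
move: v Xv {ev}; apply: kspan_min => [|_ [s [w [Ww ->]]]].
  split=> [|u v [p pmu pu] [r rmu rv]|c v [p pmu pv]].
  - by exists 1; rewrite ?hornerC ?oner_eq0 // scaler0.
  - exists (p * r); first by rewrite hornerM mulf_neq0.
    by rewrite scalerDr mulrC -horner_alg_act pu mulrC -horner_alg_act rv
      !scaler0 addr0.
  - by exists p; rewrite // kscaleC pv scaler0.
exists ('X - (mu * q ^- size s)%:P).
  rewrite hornerXsubC subr_eq0 (inj_eq (mulfI mu0)).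
  rewrite -(inj_eq (mulIf (expf_neq0 (size s) q0))) mulVf ?expf_neq0 //.
  by rewrite -exprS q_not_root.
rewrite rmorphB /= horner_algX horner_algC scalerBl (xword_weight _ Ww).
by rewrite subrr.
Qed.

(** The parity of [V]; the names are those of the fields of a supermodule. *)
Section Graded.
Variable part : bool -> V -> Prop.
Hypothesis part0 : forall a, part a 0.
Hypothesis partD : forall a u v, part a u -> part a v -> part a (u + v).
Hypothesis partZ : forall a (c : K) v, part a v -> part a (c%:A *: v).
Hypothesis part_k : forall a n v, part a v -> part a (k n *: v).
Hypothesis part_e : forall a n v, part a v -> part (~~ a) (e n *: v).
Hypothesis part_x : forall a n v, part a v -> part (~~ a) (x n *: v).
Hypothesis part_dec : forall v, exists v0 v1,
    [/\ part false v0, part true v1 & v = v0 + v1].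
Hypothesis part_disj : forall v, part false v -> part true v -> v = 0.

(** [P] contains the even and odd parts of its elements. *)
Definition graded P : Prop := forall v, P v -> exists v0 v1,
  [/\ P v0 /\ part false v0, P v1 /\ part true v1 & v = v0 + v1].

Lemma part_eq0 a u v : part a u -> part (~~ a) v -> u + v = 0 -> u = 0 /\ v = 0.
Proof.
move=> pu pv uv; have uE : u = (-1)%:A *: v.
  by rewrite kscaleN !scale1r; apply/eqP; rewrite -addr_eq0 uv.
have u0 : u = 0.
  have : part (~~ a) u by rewrite uE; apply: partZ.
  by case: a pu {pv} => p1 p2; apply: part_disj.
by split=> //; move: uv; rewrite u0 add0r.
Qed.

Lemma singular_graded : graded (@singular K A e V).
Proof.
move=> v sv; have [v0 [v1 [p0 p1 vE]]] := part_dec v.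
suff H n : e n *: v0 = 0 /\ e n *: v1 = 0.
  by exists v0, v1; split=> //; split=> // n; case: (H n).
apply: (part_eq0 (a := true)); [exact: (part_e (a := false))|exact: (part_e (a
  := true))|].
by rewrite -scalerDr -vE.
Qed.

Lemma singular_weight_graded mu : graded (singular_weight mu).
Proof.
move=> v [/singular_graded [v0 [v1 [[s0 p0] [s1 p1] vE]]] ev].
pose d u := k 0%N *: u - mu%:A *: u.
have pd a u : part a u -> part a (d u).
  move=> pu; apply: partD; first exact: part_k.
  by rewrite -kscaleN; apply: partZ.
have [d0 d1] : d v0 = 0 /\ d v1 = 0.
  apply: (part_eq0 (a := false)); [exact: pd|exact: pd|].
  by rewrite /d addrACA -opprD -!scalerDr -vE ev subrr.
by exists v0, v1; split=> //; split=> //; split=> //; apply/eqP;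
  rewrite -subr_eq0; apply/eqP.
Qed.

Lemma xspan_graded (W : V -> Prop) : graded W -> graded (xspan x W).
Proof.
move=> gW; have [X0 XD XZ] := xspan_closed x W.
apply: kspan_min => [|_ [s [w [Ww ->]]]].
  split=> [|u v [u0 [u1 [[Xu0 pu0] [Xu1 pu1] ->]]] [v0 [v1 [[Xv0 pv0] [Xv1 pv1]
    ->]]]
          |c v [v0 [v1 [[Xv0 pv0] [Xv1 pv1] ->]]]].
  - by exists 0, 0; rewrite addr0.
  - exists (u0 + v0), (u1 + v1); split; last by rewrite addrACA.
      by split; [exact: XD|exact: partD].
    by split; [exact: XD|exact: partD].
  - exists (c%:A *: v0), (c%:A *: v1); split; last by rewrite scalerDr.
      by split; [exact: XZ|exact: partZ].
    by split; [exact: XZ|exact: partZ].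
have [w0 [w1 [[W0 p0] [W1 p1] ->]]] := gW _ Ww.
elim: s => [|b s [u0 [u1 [[X0' pu0] [X1' pu1] /= ->]]]] /=.
  by exists w0, w1; split=> //; split=> //; apply: xspan_in.
exists (x b *: u1), (x b *: u0); split; last by rewrite scalerDr addrC.
  by split; [exact: xspan_x|exact: (part_x (a := true))].
by split; [exact: xspan_x|exact: (part_x (a := false))].
Qed.

(** Graded subspaces stable under the generators *)
Definition submodule P : Prop :=
  [/\ kclosed P, kstable k h ki hi P, forall n v, P v -> P (x n *: v),
      forall n v, P v -> P (e n *: v) & graded P].

Hypothesis simple : forall P, submodule P ->
  (forall v, P v -> v = 0) \/ (forall v, P v).

Lemma xspan_submodule (W : V -> Prop) : kstable k h ki hi W ->
  (forall w, W w -> singular e w) -> graded W -> submodule (xspan x W).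
Proof.
move=> Wst Ws Wg; split.
- exact: xspan_closed.
- exact: (xspan_stable q0 rel).
- exact: xspan_x.
- exact: (xspan_e q0 rel).
- exact: xspan_graded.
Qed.

Section HighestWeight.
Variables (v : V) (f1 f2 : nat -> K).
Hypothesis v0 : v != 0.
Hypothesis v_even : part false v.
Hypothesis v_sing : singular e v.
Hypothesis vk : forall n, k n *: v = (f1 n)%:A *: v.
Hypothesis vh : forall n, h n *: v = (f2 n)%:A *: v.
Hypothesis f10 : f1 0%N != 0.
Hypothesis f20 : f2 0%N != 0.

(** In a simple module a singular vector of the weight below that of the
    highest weight vector vanishes. *)
Lemma no_singular u : singular e u ->
  k 0%N *: u = (f1 0%N / q)%:A *: u -> u = 0.
Proof.
move=> su eu; have := @simple _ (xspan_submodule (singular_weight_stable (f1 0%N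
  / q))
   (fun w => @proj1 _ _) (singular_weight_graded (mu := f1 0%N / q))).
case=> [X0|/(_ v) Xv]; first by apply: X0; apply: xspan_in; split.
case/eqP: v0; apply: xspan_weight Xv _; first by rewrite mulf_neq0 ?invr_eq0.
by rewrite divfK.
Qed.

Lemma inv_eigen (y yi : A) (c : K) : yi * y = 1 -> c != 0 ->
  y *: v = c%:A *: v -> yi *: v = c^-1%:A *: v.
Proof.
move=> yy c0 yv; have : yi *: (y *: v) = v by rewrite scalerA yy scale1r.
rewrite yv kscaleC => E.
by rewrite -[in RHS]E kscaleA mulVf // !scale1r.
Qed.

(** A simple module is spanned by words in lowering operators applied to its
    highest weight vector. *)
Lemma xspan_line u : xspan x (fun w => w = v) u.
Proof.
pose W w := exists c : K, w = c%:A *: v.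
have XW : forall w, xspan x W w -> xspan x (fun w => w = v) w.
  apply: kspan_min => [|_ [s [_ [[c ->] ->]]]]; first exact: kspan_closed.
  elim: s => [|b s IH] /=; last exact: xspan_x.
  by apply: kspanZ; apply: xspan_in.
apply: XW; have := @simple (xspan x W) (xspan_submodule _ _ _).
case.
- split=> [n w [c ->]|n w [c ->]|w [c ->]|w [c ->]].
  + by exists (c * f1 n); rewrite kscaleC vk kscaleA.
  + by exists (c * f2 n); rewrite kscaleC vh kscaleA.
  + by exists (c / f1 0%N); rewrite kscaleC (inv_eigen (gl_kVk rel) f10) //
    kscaleA.
  + by exists (c / f2 0%N); rewrite kscaleC (inv_eigen (gl_hVh rel) f20) //
    kscaleA.
- by move=> w [c ->] n; rewrite kscaleC v_sing scaler0.
- move=> w [c ->]; exists (c%:A *: v), 0; rewrite addr0; split=> //.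
    by split; [exists c|exact: partZ].
  by split; [exists 0; rewrite !scale0r|].
- move=> X0; case/eqP: v0; apply: X0; apply: xspan_in.
  by exists 1; rewrite !scale1r.
- by [].
Qed.

Lemma hk_v a b : h a *: (k b *: v) = (f2 a * f1 b)%:A *: v.
Proof. by rewrite vk kscaleC vh kscaleA mulrC. Qed.

(** The vector [e a *: (x b *: v)] is a multiple of [v] determined by the
    eigenvalues [f1] and [f2]. *)
Lemma ex_v0 b : e 0%N *: (x b *: v) =
  ((q - q^-1) * (f2 0%N * f1 b - f2 b * f1 0%N))%:A *: v.
Proof.
set r := RHS; rewrite scalerA (gl_ex0 rel) !(scalerDl,
  scaleNr) !kscaleM -!scalerA.
rewrite v_sing scaler0 !hk_v /r.
by linear_with K (@leval_eq_mod K A V); ring.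
Qed.

Lemma ex_vS a b : e a.+1 *: (x b *: v) = e a *: (x b.+1 *: v) +
  ((q - q^-1) * (f2 a.+1 * f1 b - f2 b * f1 a.+1))%:A *: v.
Proof.
set r := _%:A *: v; rewrite scalerA (gl_ex rel) !(scalerDl,
  scaleNr) !kscaleM -!scalerA.
rewrite !v_sing !scaler0 !hk_v /r.
by linear_with K (@leval_eq_mod K A V); ring.
Qed.

End HighestWeight.
End Graded.
End Weights.

(** * Power series *)

Section PowerSeriesRing.
Variable K : fieldType.
Implicit Types f g h : pseries K.

Lemma ps_mul_poly N f g n : (n < N)%N ->
  ps_mul f g n = ((\poly_(i < N) f i) * (\poly_(i < N) g i))`_n.
Proof.
move=> nN; rewrite coefM; apply: eq_bigr => i _.
by rewrite !coef_poly !ifT //; case: i => i /=; lia.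
Qed.

Lemma ps_mulC f g : ps_mul f g = ps_mul g f.
Proof. by apply: funext => n; rewrite !(ps_mul_poly _ _ (ltnSn n)) mulrC. Qed.

Lemma ps_mulA f g h : ps_mul f (ps_mul g h) = ps_mul (ps_mul f g) h.
Proof.
apply: funext => n; pose T f := \poly_(i < n.+1) f i : {poly K}.
transitivity ((T f * (T g * T h))`_n).
  rewrite coefM; apply: eq_bigr => -[i /= ?] _.
  by rewrite (ps_mul_poly (N := n.+1)) ?[(T f)`_i]coef_poly ?ifT //; lia.
rewrite mulrA coefM; apply: eq_bigr => -[i /= ?] _.
by rewrite (ps_mul_poly (N := n.+1)) ?[(T h)`_(n - i)]coef_poly ?ifT //; lia.
Qed.

Lemma ps_mul1 f : ps_mul f (@ps_one K) = f.
Proof.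
apply: funext => n; rewrite /ps_mul big_ord_recr /= subnn mulr1 big1 ?add0r //.
by case=> i /= ?; rewrite /ps_one (_ : (n - i == 0)%N = false) ?mulr0 //; lia.
Qed.

Lemma ps_mulACA f g h : ps_mul f (ps_mul g h) = ps_mul g (ps_mul f h).
Proof. by rewrite !ps_mulA (ps_mulC f). Qed.

Lemma ps_mulDr f g h : ps_mul f (fun n => g n + h n) =
  (fun n => ps_mul f g n + ps_mul f h n).
Proof.
apply: funext => n; rewrite -big_split /=.
by apply: eq_bigr => i _; rewrite mulrDr.
Qed.

Lemma ps_mul_inv f : f 0%N != 0 -> ps_mul f (ps_inv f) = @ps_one K.
Proof. by move/ps_mulV/funext. Qed.

(** The monomial z^d *)
Definition ps_X (d : nat) : pseries K := fun n => (n == d)%:R.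

Lemma ps_mul_X d f n :
  ps_mul (ps_X d) f n = if (d <= n)%N then f (n - d)%N else 0.
Proof.
rewrite /ps_mul /ps_X; case: leqP => dn.
  rewrite (bigD1 (Ordinal (dn : (d < n.+1)%N))) //= eqxx mul1r big1 ?addr0 //.
  by move=> i; rewrite -val_eqE /= => /negPf ->; rewrite mul0r.
apply: big1 => -[i /= ?] _.
by rewrite (_ : (i == d) = false) ?mul0r //; lia.
Qed.

Lemma ps_mulCA4 f g h l :
  ps_mul (ps_mul f g) (ps_mul h l) = ps_mul (ps_mul f h) (ps_mul g l).
Proof. by rewrite -!ps_mulA (ps_mulACA g). Qed.

(** Equality of the fractions f1 / f2 and p / r, cross-multiplied *)
Lemma ps_div_eq f1 f2 p r : f2 0%N != 0 -> r 0%N != 0 ->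
  ps_div f1 f2 = ps_div p r <-> ps_mul f1 r = ps_mul p f2.
Proof.
move=> f20 r0; rewrite /ps_div; split=> E.
  rewrite -[LHS]ps_mul1 -(ps_mul_inv f20) (ps_mulC f2) ps_mulCA4 E.
  by rewrite (ps_mulC r) ps_mulCA4 (ps_mulC _ r) ps_mul_inv // ps_mul1.
rewrite -[LHS]ps_mul1 -(ps_mul_inv r0) ps_mulCA4 E.
by rewrite (ps_mulC (ps_inv f2)) ps_mulCA4 ps_mul_inv // ps_mul1.
Qed.

End PowerSeriesRing.

(** * Finite dimension and rational functions *)

Section Rationality.
Variables (K : fieldType) (A : algType K) (q : K).
Variables (k e x h : nat -> A) (ki hi : A).
Hypothesis q0 : q != 0.
Hypothesis q_not_root : forall n : nat, (0 < n)%N -> q ^+ n != 1.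
Hypothesis rel : gl11_relations q k e x h ki hi.
Variable V : lmodType A.
Variables (v : V) (f1 f2 : pseries K).
Hypothesis v0 : v != 0.
Hypothesis v_sing : singular e v.
Hypothesis vk : forall n, k n *: v = (f1 n)%:A *: v.
Hypothesis vh : forall n, h n *: v = (f2 n)%:A *: v.
Hypothesis f10 : f1 0%N != 0.
Hypothesis f20 : f2 0%N != 0.

Let ex0 := ex_v0 rel v_sing vk vh.
Let exS := ex_vS rel v_sing vk vh.

(** The series with coefficients \sum_i c_i f_(i + 1 + m). The shift by one is
  due
    to x_0 = 0: the vectors x_1 v, x_2 v, ... are the ones to compare. *)
Definition ps_contract (c : nat -> K) n (f : pseries K) : pseries K :=
  fun m => \sum_(i < n) c i * f (i.+1 + m)%N.

(** For m = 0 the left-hand side vanishes when [c] is a dependence, and the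
    right-hand side is the coefficient of z^a in f2 l(f1) - f1 l(f2). *)
Lemma e_contract (c : nat -> K) n a m :
  e a *: (\sum_(i < n) (c i)%:A *: (x (i.+1 + m) *: v)) =
  ((q - q^-1) * \sum_(j < a.+1) (f2 j * ps_contract c n f1 (m + (a - j))%N
      - f1 j * ps_contract c n f2 (m + (a - j))%N))%:A *: v.
Proof.
elim: a m => [|a IH] m.
  rewrite big_ord_recl big_ord0 addr0 subnn addn0 /ps_contract !mulr_sumr -sumrB
    mulr_sumr.
  rewrite ksuml scaler_sumr; apply: eq_bigr => i _.
  by rewrite kscaleC ex0 kscaleA; congr (_%:A *: _); ring.
transitivity (e a *: (\sum_(i < n) (c i)%:A *: (x (i.+1 + m.+1) *: v)) +
   ((q - q^-1) * (f2 a.+1 * ps_contract c n f1 m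
      - f1 a.+1 * ps_contract c n f2 m))%:A *: v).
  rewrite /ps_contract !mulr_sumr -sumrB mulr_sumr ksuml !scaler_sumr -big_split
    /=.
  apply: eq_bigr => i _; rewrite kscaleC exS addnS scalerDr kscaleA.
  by rewrite [in RHS]kscaleC; congr (_ + _%:A *: _); ring.
rewrite IH -kscaleDl -mulrDr [in RHS]big_ord_recr /= subnn addn0.
congr ((_ * (_ + _))%:A *: _); apply: eq_bigr => -[j /= ja] _.
by rewrite (_ : m.+1 + (a - j) = m + (a.+1 - j))%N //; lia.
Qed.

Lemma finspan_rational : finspan V -> exists P Q : {poly K},
  [/\ P`_0 != 0, Q`_0 != 0 &
      ps_mul f1 (ps_of_poly Q) = ps_mul (ps_of_poly P) f2].
Proof.
move=> /finspan_dep [n dep].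
have [c [i lt_in ci] cx] := dep (fun i => x i.+1 *: v).
(* [N] is the last index with a non-zero coefficient. *)
have exP : exists i, (i < n)%N && (c i != 0) by exists i; rewrite lt_in.
have ubP j : (j < n)%N && (c j != 0) -> (j <= n)%N by case/andP=> /ltnW.
have [N /andP [Nn cN] Nmax] := ex_maxnP exP ubP.
pose l := ps_contract c N.+1.
(* [r] is the polynomial with the coefficients of [c] in reverse order, and
   [p f] is the part of degree at most [N] of the product [r f]. *)
pose r : pseries K := fun j => if (j <= N)%N then c (N - j)%N else 0.
have cx' : \sum_(i < N.+1) (c i)%:A *: (x (i.+1 + 0) *: v) = 0.
  rewrite -[RHS]cx (big_ord_widen n (fun i =>
    (c i)%:A *: (x (i.+1 + 0) *: v))) //.
  rewrite [RHS](bigID (fun i : 'I_n => (i < N.+1)%N)) /= [X in _ =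
    _ + X]big1 ?addr0.
    by apply: eq_bigr => j _; rewrite addn0.
  move=> j jN; have [-> | cj] := eqVneq (c j) 0; first by rewrite !scale0r.
  by case/negP: jN; apply: Nmax; rewrite ltn_ord.
have g0 : q - q^-1 != 0.
  rewrite subr_eq0; apply: contraNneq (q_not_root (isT : 0 < 2)%N) => qq.
  by rewrite expr2 {1}qq mulVf.
have lf : ps_mul f2 (l f1) = ps_mul f1 (l f2).
  apply: funext => a; apply/eqP; rewrite -subr_eq0 -sumrB;
    apply: contrapT => /negP S0.
  have := e_contract c N.+1 a 0; rewrite cx' scaler0 => /esym.
  by move/kscale_eq0 => -/(_ (mulf_neq0 g0 S0)) /eqP; rewrite (negPf v0).
pose p f : pseries K := fun m => if (m <= N)%N then ps_mul r f m else 0.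
have rf f : ps_mul r f = (fun m => p f m + ps_mul (ps_X K N.+1) (l f) m).
  apply: funext => m; rewrite ps_mul_X /p; have [mN|Nm] := leqP m N;
    first by rewrite addr0.
  rewrite add0r /ps_mul (bigID (fun j : 'I_m.+1 => (j < N.+1)%N)) /=.
  rewrite [X in _ + X]big1 ?addr0; last first.
    by move=> j; rewrite -leqNgt /r leqNgt => Nj; rewrite ifF ?mul0r //; lia.
  rewrite -(big_ord_widen m.+1 (fun j => r j * f (m - j)%N)) 1?ltnW //.
  rewrite (reindex_inj rev_ord_inj) /=; apply: eq_bigr => -[j /= jN] _.
  by rewrite /r ifT; [congr (c _ * f _)|]; lia.
have pf f : ps_of_poly (\poly_(i < N.+1) p f i) = p f.
  apply: funext => m; rewrite /ps_of_poly coef_poly ltnS /p.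
  by case: (m <= N)%N.
have pf0 f : f 0%N != 0 -> (\poly_(i < N.+1) p f i)`_0 != 0.
  move=> ff; rewrite coef_poly /= /p /= /ps_mul big_ord_recl big_ord0 addr0 /r
    /= subn0.
  by rewrite mulf_neq0.
exists (\poly_(i < N.+1) p f1 i), (\poly_(i < N.+1) p f2 i).
split; [exact: pf0|exact: pf0|rewrite !pf].
have : ps_mul f1 (ps_mul r f2) = ps_mul f2 (ps_mul r f1).
  by rewrite ps_mulACA [RHS]ps_mulACA (ps_mulC f1).
rewrite !rf !ps_mulDr !(ps_mulACA _ (ps_X K _)) lf => E.
apply: funext => m; have := congr1 (fun f => f m) E => /=.
by move/addIr; rewrite (ps_mulC f2).
Qed.

(** The coefficient of z^n in u(z) x(z) v *)
Definition xtwist (u : pseries K) n : V :=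
  \sum_(j < n.+1) (u (n - j)%N)%:A *: (x j *: v).

Lemma xtwist0 u n : e 0%N *: xtwist u n =
  ((q - q^-1) * (f2 0%N * ps_mul f1 u n - ps_mul f2 u n * f1 0%N))%:A *: v.
Proof.
rewrite /xtwist /ps_mul mulr_sumr mulr_suml -sumrB mulr_sumr ksuml scaler_sumr.
apply: eq_bigr => j _; rewrite kscaleC ex0 kscaleA; congr (_%:A *: _); ring.
Qed.

(** The term [j = 0] of [xtwist u n.+1] vanishes as x_0 = 0. *)
Lemma xtwistS u n a : e a.+1 *: xtwist u n = e a *: xtwist u n.+1 +
  ((q - q^-1) * (f2 a.+1 * ps_mul f1 u n - ps_mul f2 u n * f1 a.+1))%:A *: v.
Proof.
rewrite {2}/xtwist big_ord_recl (gl_x0 rel) scale0r scaler0 add0r.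
rewrite /xtwist /ps_mul !mulr_sumr mulr_suml -sumrB mulr_sumr ksuml
  !scaler_sumr.
rewrite -big_split; apply: eq_bigr => j _ /=.
rewrite kscaleC exS scalerDr kscaleA subSS [in RHS]kscaleC.
by congr (_ + _%:A *: _); ring.
Qed.

Section Rational.
Variables (u : pseries K) (D : nat).
Hypothesis u0 : u 0%N != 0.
Hypothesis uf1 : forall n, (D <= n)%N -> ps_mul f1 u n = 0.
Hypothesis uf2 : forall n, (D <= n)%N -> ps_mul f2 u n = 0.

(** The recursion down to e_0 only increases [n], so that [uf1] and [uf2] keep
    applying. *)
Lemma xtwist_singular n : (D <= n)%N -> singular e (xtwist u n).
Proof.
move=> Dn a; elim: a n Dn => [|a IH] n Dn.
  by rewrite xtwist0 uf1 // uf2 // mulr0 mul0r subrr mulr0 !scale0r.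
rewrite xtwistS uf1 // uf2 // mulr0 mul0r subrr mulr0 !scale0r addr0.
by apply: IH; apply: leqW.
Qed.

Lemma xtwist_weight n :
  k 0%N *: xtwist u n = (f1 0%N / q)%:A *: xtwist u n.
Proof.
rewrite /xtwist !scaler_sumr; apply: eq_bigr => j _.
rewrite kscaleC scalerA (gl_kx0 rel) kscaleM vk !kscaleA kscaleC kscaleA.
by congr (_%:A *: _); ring.
Qed.

Lemma xtwist_red n : xtwist u n = 0 ->
  kspan (fun w => exists2 m, (m < n)%N & w = x m *: v) (x n *: v).
Proof.
rewrite /xtwist big_ord_recr /= subnn => /eqP; rewrite addrC addr_eq0 => /eqP E.
have -> : x n *: v = (u 0%N)^-1%:A *: ((u 0%N)%:A *: (x n *: v)).
  by rewrite kscaleA mulVf // !scale1r.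
rewrite E; apply: kspanZ; apply: kclosedN; first exact: kspan_closed.
apply: kclosed_sum; first exact: kspan_closed.
move=> j _; apply: kspanZ; apply: kspan_in; by exists j.
Qed.

End Rational.
End Rationality.

(** * Supermodules over the q-Yangian *)

Section YangianRelations.
Variables (K : fieldType) (q : K).
Hypothesis q0 : q != 0.
Local Notation Y := (Yq q).

Fact Yt_subproof i : Ut q i i 0 \in @in_Yqb K q.
Proof. exact/asboolP/inYq_sV. Qed.

(** The inverse of s_ii^(0) *)
Definition Yt i : Y := MkYq (Yt_subproof i).

Lemma Yts i : Yt i * Ys q i i 0 = 1.
Proof. apply: Yval_inj; exact: UtsK. Qed.

Lemma Yst i : Ys q i i 0 * Yt i = 1.
Proof. apply: Yval_inj; exact: UstK. Qed.

Lemma Ys21_0 : Ys q ix2 ix1 0 = 0.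
Proof. by apply: Yval_inj; apply/Upi_eq0/relideal_gen; apply: relS0. Qed.

Lemma Yq_relations : gl11_relations q (Ys q ix1 ix1) (Ys q ix1 ix2)
  (Ys q ix2 ix1) (Ys q ix2 ix2) (Yt ix1) (Yt ix2).
Proof.
have rtt := @YRTT K q.
have neg n i j : Sz q (Negz n) i j = 0 by [].
have z : Sz q 0 ix2 ix1 = 0 := Ys21_0.
split.
- exact: Ys21_0.
- exact: Yts.
- exact: Yst.
- exact: Yts.
- exact: Yst.
- exact: (relation_kk q0 rtt neg).
- exact: (relation_hh q0 rtt neg).
- exact: (relation_k0e q0 rtt neg).
- exact: (relation_ek q0 rtt).
- exact: (relation_eh0 q0 rtt neg).
- exact: (relation_eh q0 rtt).
- exact: (relation_k0x q0 rtt neg z).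
- exact: (relation_kx q0 rtt).
- exact: (relation_h0x q0 rtt neg z).
- exact: (relation_hx q0 rtt).
- exact: (relation_e0x q0 rtt neg).
- exact: (relation_ex q0 rtt).
- exact: (relation_k0h rtt neg z).
- exact: (relation_kh q0 rtt).
- exact: (relation_xx q0 rtt).
Qed.

(** Induction on the generation of the q-Yangian *)
Lemma Yq_ind (P : Y -> Prop) :
  (forall i j n, P (Ys q i j n)) -> (forall i, P (Yt i)) -> P 1 ->
  (forall (c : K) y, P y -> P (c *: y)) ->
  (forall y z, P y -> P z -> P (y + z)) ->
  (forall y z, P y -> P z -> P (y * z)) -> forall y, P y.
Proof.
move=> Ps Pt P1 PZ PD PM [u hu].
have uY : in_Yq u by exact/asboolP.
suff [y yu Py] : exists2 y : Y, Yval y = u & P y.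
  have -> : MkYq hu = y by apply: Yval_inj; exact: esym yu.
  exact: Py.
clear hu; elim: uY => [i j n|i||c v _ [y yv Py]|v w _ [y yv Py] _ [z zw Pz]|v w
  _ [y yv Py] _ [z zw Pz]].
- by exists (Ys q i j n).
- by exists (Yt i).
- by exists 1.
- by exists (c *: y); [rewrite -yv|exact: PZ].
- by exists (y + z); [rewrite -yv -zw|exact: PD].
- by exists (y * z); [rewrite -yv -zw|exact: PM].
Qed.

Lemma Uq_homogM a b (u v : Uq q) :
  Uq_homog a u -> Uq_homog b v -> Uq_homog (a (+) b) (u * v).
Proof.
move=> [x hx ->] [y hy ->]; exists (x * y); last by rewrite Upi_mul.
move=> w /msuppM_le [w1 [w2 [/hx <- /hy <- ->]]].
by rewrite /wpar fmM big_cat.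
Qed.

Lemma Uq_homogD a (u v : Uq q) :
  Uq_homog a u -> Uq_homog a v -> Uq_homog a (u + v).
Proof.
move=> [x hx ->] [y hy ->]; exists (x + y); last by rewrite UpiD.
move=> w /(fsubsetP (msuppD_le _ _)); rewrite in_fsetU.
by case/orP=> [/hx|/hy].
Qed.

Lemma Uq_homogZ a (c : K) (u : Uq q) : Uq_homog a u -> Uq_homog a (c *: u).
Proof.
move=> [x hx ->]; exists (c *: x); last by rewrite Upi_scale.
by move=> w /(fsubsetP (msuppZ_le _ _)) /hx.
Qed.

Lemma Uq_homog0 a : Uq_homog a (0 : Uq q).
Proof. by exists 0; [move=> w; rewrite msupp0|rewrite Upi0]. Qed.

Lemma Uq_homog1 : Uq_homog false (1 : Uq q).
Proof.
exists 1; last by [].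
by have := @Free_homog_alg K 1; rewrite scale1r.
Qed.

Lemma Ys_homog i j n : Yq_homog (epar i j) (Ys q i j n).
Proof. by exists (gs K i j n) => //; apply: (@Free_homogU K (true, i, j,
  n)). Qed.

Lemma Yt_homog i : Yq_homog false (Yt i).
Proof.
exists (gt K i i 0) => //.
by have := @Free_homogU K (false, i, i, 0%N); rewrite /gpar /epar addbb.
Qed.

Lemma Yq_homog_alg (c : K) : Yq_homog false (c%:A : Y).
Proof. exact: (Uq_homogZ c Uq_homog1). Qed.

(** Every element of the q-Yangian is the sum of an even and an odd one. *)
Lemma Yq_homog_dec (y : Y) : exists y0 y1 : Y,
  [/\ Yq_homog false y0, Yq_homog true y1 & y = y0 + y1].
Proof.
move: y; have H0 a : Yq_homog a (0 : Y) by exact: Uq_homog0.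
have HD a (y z : Y) : Yq_homog a y -> Yq_homog a z -> Yq_homog a (y + z).
  exact: Uq_homogD.
have HM a b (y z : Y) : Yq_homog a y -> Yq_homog b z -> Yq_homog (a (+) b) (y *
  z).
  exact: Uq_homogM.
apply: Yq_ind.
- move=> i j n; have := Ys_homog i j n; case: (epar i j) => h.
    by exists 0, (Ys q i j n); rewrite add0r.
  by exists (Ys q i j n), 0; rewrite addr0.
- by move=> i; exists (Yt i), 0; rewrite addr0; split=> //; apply: Yt_homog.
- by exists 1, 0; rewrite addr0; split=> //; apply: Uq_homog1.
- move=> c _ [y0 [y1 [h0 h1 ->]]]; exists (c *: y0), (c *: y1); split;
  last by rewrite scalerDr.
    exact: (Uq_homogZ c h0).
  exact: (Uq_homogZ c h1).
- move=> _ _ [y0 [y1 [h0 h1 ->]]] [z0 [z1 [g0 g1 ->]]].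
  by exists (y0 + z0), (y1 + z1); split; [exact: HD|exact: HD|exact: addrACA].
- move=> _ _ [y0 [y1 [h0 h1 ->]]] [z0 [z1 [g0 g1 ->]]].
  exists (y0 * z0 + y1 * z1), (y0 * z1 + y1 * z0); split.
  + by apply: HD; [apply: (HM false false)|apply: (HM true true)].
  + by apply: HD; [apply: (HM false true)|apply: (HM true false)].
  + by rewrite mulrDl !mulrDr [y1 * z0 + _]addrC addrACA.
Qed.

End YangianRelations.

Section SuperModules.
Variables (K : fieldType) (q : K).
Hypothesis q0 : q != 0.
Hypothesis q_not_root : forall n : nat, (0 < n)%N -> q ^+ n != 1.
Variable V : supermodule q.
Local Notation Y := (Yq q).
Local Notation sk := (Ys q ix1 ix1).
Local Notation se := (Ys q ix1 ix2).
Local Notation sx := (Ys q ix2 ix1).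
Local Notation sh := (Ys q ix2 ix2).
Implicit Types (u v w : V).

Lemma partZ a (c : K) v : part a v -> part a ((c%:A : Y) *: v).
Proof. exact: (part_act (Yq_homog_alg q c)). Qed.

Lemma part_s i j a n v : part a v -> part (epar i j (+) a) (Ys q i j n *: v).
Proof. exact: (part_act (Ys_homog q i j n)). Qed.

Lemma part_sk a n v : part a v -> part a (sk n *: v).
Proof. exact: (@part_s ix1 ix1). Qed.
Lemma part_sh a n v : part a v -> part a (sh n *: v).
Proof. exact: (@part_s ix2 ix2). Qed.
Lemma part_se a n v : part a v -> part (~~ a) (se n *: v).
Proof. exact: (@part_s ix1 ix2). Qed.
Lemma part_sx a n v : part a v -> part (~~ a) (sx n *: v).
Proof. exact: (@part_s ix2 ix1). Qed.

(** Stability under the generators suffices. *)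
Lemma submodule_Yq (P : V -> Prop) :
  submodule sk se sx sh (Yt q ix1) (Yt q ix2) (@part K q V) P ->
    graded_submodule P.
Proof.
case=> [[P0 PD PZ] [Pk Ph Pki Phi] Px Pe gP]; split=> //.
move=> y v; move: y v; apply: Yq_ind.
- move=> i j n v; case: (ord2P i) => ->; case: (ord2P j) => ->.
  + exact: Pk.
  + exact: Pe.
  + exact: Px.
  + exact: Ph.
- move=> i v; case: (ord2P i) => ->; [exact: Pki|exact: Phi].
- by move=> v; rewrite scale1r.
- by move=> c y Py v Pv; rewrite kscaleE; apply/PZ/Py.
- by move=> y z Py Pz v Pv; rewrite scalerDl; apply: PD; [exact: Py|exact: Pz].
- by move=> y z Py Pz v Pv; rewrite -scalerA; apply/Py/Pz.
Qed.

Lemma simple_submodule : simple_module V -> forall P : V -> Prop,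
  submodule sk se sx sh (Yt q ix1) (Yt q ix2) (@part K q V) P ->
  (forall v, P v -> v = 0) \/ (forall v, P v).
Proof. by case=> _ simV P /submodule_Yq /simV. Qed.

(** In a simple module every non-zero homogeneous vector is a generator. *)
Lemma simple_generated v a : simple_module V -> part a v -> v != 0 ->
  generated_by v.
Proof.
move=> [_ simV] pv v0; pose P u := exists y : Y, u = y *: v.
have [] := simV P; last by [].
- split.
  + by exists 0; rewrite scale0r.
  + by move=> _ _ [y ->] [z ->]; exists (y + z); rewrite scalerDl.
  + by move=> y _ [z ->]; exists (y * z); rewrite scalerA.
  + move=> _ [y ->]; have [y0 [y1 [h0 h1 ->]]] := Yq_homog_dec y.
    have p0 := part_act h0 pv; have p1 := part_act h1 pv.
    case: a pv p0 p1 => /= pv p0 p1.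
      exists (y1 *: v), (y0 *: v); split; last by rewrite scalerDl addrC.
        by split; [exists y1|].
      by split; [exists y0|].
    exists (y0 *: v), (y1 *: v); split; last by rewrite scalerDl.
      by split; [exists y0|].
    by split; [exists y1|].
- move=> P0; case/eqP: v0; apply: P0; exists 1; by rewrite scale1r.
Qed.

Section HighestWeightVector.
Variables (v : V) (f1 f2 : pseries K).
Hypothesis simV : simple_module V.
Hypothesis hv : hlw_vector v.
Hypothesis v_even : part false v.
Hypothesis vk : forall n, sk n *: v = ((f1 n)%:A : Y) *: v.
Hypothesis vh : forall n, sh n *: v = ((f2 n)%:A : Y) *: v.
Hypothesis f10 : f1 0%N != 0.
Hypothesis f20 : f2 0%N != 0.

(** The characterisation of finite dimension over an arbitrary field *)
Lemma fin_dim_rational : fin_dim V <-> exists P Q : {poly K},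
  [/\ P`_0 != 0, Q`_0 != 0 &
      ps_div f1 f2 =1 ps_div (ps_of_poly P) (ps_of_poly Q)].
Proof.
have [v0 _ v_sing _] := hv; have rel := Yq_relations q0.
split=> [fV|[P [Q [P0 Q0 /funext E]]]].
  have [P [Q [P0 Q0 E]]] := finspan_rational q0 q_not_root rel v0 v_sing vk vh
    f10 f20 fV.
  exists P, Q; split=> // n; congr (_ n).
  by apply/ps_div_eq.
have {}E := (ps_div_eq _ _ f20 (Q0 : ps_of_poly Q 0%N != 0)).1 E.
pose u := ps_mul (ps_of_poly Q) (ps_inv f2).
have f2u : ps_mul f2 u = ps_of_poly Q.
  by rewrite /u ps_mulACA ps_mul_inv // ps_mul1.
have f1u : ps_mul f1 u = ps_of_poly P.
  by rewrite /u ps_mulA E -ps_mulA ps_mul_inv // ps_mul1.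
have u0 : u 0%N != 0.
  apply: contraNneq Q0 => u0; rewrite -[Q`_0]/(ps_of_poly Q 0) -f2u.
  by rewrite /ps_mul big_ord_recl big_ord0 subnn u0 mulr0 addr0.
pose D := maxn (size P) (size Q).
have uf1 n : (D <= n)%N -> ps_mul f1 u n = 0.
  by move=> Dn; rewrite f1u /ps_of_poly nth_default // (leq_trans _ Dn) //
    leq_maxl.
have uf2 n : (D <= n)%N -> ps_mul f2 u n = 0.
  by move=> Dn; rewrite f2u /ps_of_poly nth_default // (leq_trans _ Dn) //
    leq_maxr.
have simp := simple_submodule simV.
have dec := @part_dec K q V; have disj := @part_disj K q V.
have q2 : 1 + q ^+ 2 != 0.
  apply: contraNneq (q_not_root (isT : 0 < 4)%N) => q2.
  by rewrite (exprM q 2 2) (_ : q ^+ 2 = -1) ?sqrrN ?expr1n //; apply/eqP;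
    rewrite -addr_eq0 addrC q2.
have red n : (D <= n)%N -> kspan (fun w => exists2 m, (m < n)%N & w =
  sx m *: v) (sx n *: v).
  move=> Dn; apply: (xtwist_red u0).
  apply: (no_singular q0 q_not_root rel (@part0 K q V) (@partD K q V) partZ
    part_sk
    part_se part_sx dec disj simp v0 vk f10).
  - exact: (xtwist_singular rel v_sing vk vh uf1 uf2).
  - exact: (xtwist_weight rel vk).
apply: (good_word_fin (x := sx) (v := v) (D := D)) => w.
have Xw := xspan_line q0 rel (@part0 K q V) (@partD K q V) partZ part_sx simp v0
  v_even
  v_sing vk vh f10 f20 w.
apply: kspan_min Xw => [|_ [s [_ [-> ->]]]]; first exact: kspan_closed.
exact: (xword_good q0 rel q2 red).
Qed.

End HighestWeightVector.
End SuperModules.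

(** * Existence of highest weight vectors *)

Lemma expf_inj (K : fieldType) (q : K) : q != 0 ->
  (forall n : nat, (0 < n)%N -> q ^+ n != 1) -> injective (fun n => q ^+ n).
Proof.
move=> q0 qn i j /eqP; wlog ij : i j / (i <= j)%N => [H E|].
  by have [/H|/ltnW /H] := leqP i j; [apply|rewrite eq_sym => ->].
rewrite -(subnK ij) exprD -[X in X == _]mul1r (inj_eq (mulIf (expf_neq0 _ q0)))
  eq_sym.
by case: (j - i)%N => // d; rewrite (negPf (qn d.+1 _)).
Qed.

Section HighestWeightExistence.
Variables (K : closedFieldType) (q : K).
Hypothesis q0 : q != 0.
Hypothesis q_not_root : forall n : nat, (0 < n)%N -> q ^+ n != 1.
Variable V : supermodule q.
Local Notation Y := (Yq q).
Local Notation sk := (Ys q ix1 ix1).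
Local Notation se := (Ys q ix1 ix2).
Local Notation sx := (Ys q ix2 ix1).
Local Notation sh := (Ys q ix2 ix2).
Local Notation sing := (@singular K Y se V).

Lemma exists_singular : fin_dim V -> (exists v : V, v != 0) ->
  exists2 w : V, w != 0 & sing w.
Proof.
move=> fV [v v0]; have rel := Yq_relations q0; apply: contrapT => nosing.
have [c [u [_ u0 cu]]] : exists c : K, exists u : V,
    [/\ True, u != 0 & sk 0 *: u = (c%:A : Y) *: u].
  by apply: (eigenvector fV (P := fun _ => True) _ _ _ v0).
have c0 : c != 0.
  apply: contraNneq u0 => c0; move: cu; rewrite c0 !scale0r => cu.
  by rewrite -[u]scale1r -(gl_kVk rel) -scalerA cu scaler0.
(* Iterating the operators e_n from [u] gives eigenvectors of k_0 with the
   pairwise distinct eigenvalues c q^i. *)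
have step (w : V) : exists w' : V, w != 0 -> w' != 0 /\ exists n, w' =
  se n *: w.
  have [w0|w0] := eqVneq w 0; first by exists 0.
  have [n wn] : exists n, se n *: w != 0.
    apply: contrapT => H; apply: nosing; exists w => // n.
    by apply/eqP; apply: contrapT => /negP wn; apply: H; exists n.
  by exists (se n *: w) => _; split=> //; exists n.
have [F FP] := choice step.
pose w i := iter i F u.
have w0 i : w i != 0 by elim: i => //= i IH; case: (FP (w i) IH).
have [] := @eigen_finite K Y V (sk 0) (fun i => c * q ^+ i) w fV.
- by move=> i j /(mulfI c0) /(expf_inj q0 q_not_root).
- elim=> [|i IH]; first by rewrite expr0 mulr1.
  have [_ [n wn]] := FP _ (w0 i); rewrite [w i.+1]wn scalerA (gl_ke0 rel)
    kscaleM IH.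
  by rewrite kscaleC kscaleA exprS mulrCA.
- by move=> i /eqP; rewrite (negPf (w0 i)).
Qed.

Lemma simple_highest_lweight : fin_dim V -> simple_module V -> highest_lweight
  V.
Proof.
move=> fV simV; have rel := Yq_relations q0.
have [w w0 sw] := exists_singular fV simV.1.
have [a [t [pt t0 st]]] : exists a t, [/\ @part K q V a t, t != 0 & sing t].
  have [w' [w'' [[s' p'] [s'' p''] E]]] := singular_graded (@partZ K q V)
    (@part_se K q V)
     (@part_dec K q V) (@part_disj K q V) sw.
  have [w0'|] := eqVneq w' 0; last by exists false, w'.
  by exists true, w''; split=> //; move: w0; rewrite E w0' add0r.
pose P (u : V) := part a u /\ sing u.
have kP : kclosed P.
  have [S0 SD SZ] := singular_closed se V.
  split=> [|u u' [pu su] [pu' su']|c u [pu su]].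
  - by split; [exact: part0|].
  - by split; [exact: partD|exact: SD].
  - by split; [exact: partZ|exact: SZ].
have [Sk Sh _ _] := singular_stable q0 rel V.
pose y (i : bool * nat) := if i.1 then sk i.2 else sh i.2.
have [|[b n] [b' n'] u [pu su]||u [[pu su] u0 yu]] :=
    @commuting_eigenvector K Y V fV _ y P t kP _ _ _ t0.
- by move=> [[] n] u [pu su]; split; [exact: part_sk|exact: Sk|exact:
  part_sh|exact: Sh].
- case: b b' => [] [] /=.
  + by rewrite !scalerA (gl_kk rel).
  + exact: (singular_kh rel).
  + exact/esym/(singular_kh rel).
  + by rewrite !scalerA (gl_hh rel).
- by split.
exists u; split; last exact: (simple_generated simV pu u0).
split=> // [|n]; first by case: a pu {pt P kP} => pu; [right|left].
by split; [exact: (yu (true, n))|exact: (yu (false, n))].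
Qed.

End HighestWeightExistence.

Theorem lemma4p1 (R : realType) (q : R[i]) (q_neq0 : q != 0)
    (q_not_root : forall n : nat, (0 < n)%N -> q ^+ n != 1) :
  (forall V : supermodule q,
     fin_dim V -> simple_module V -> highest_lweight V) /\
  (forall (S : supermodule q) (v : S) (f1 f2 : pseries R[i]),
     simple_module S -> hlw_vector v -> generated_by v ->
     part false v ->
     (forall n, Ys q ix1 ix1 n *: v = (f1 n)%:A *: v) ->
     (forall n, Ys q ix2 ix2 n *: v = (f2 n)%:A *: v) ->
     ps_unit f1 -> ps_unit f2 ->
     (fin_dim S <->
      exists P Q : {poly R[i]},
        [/\ P`_0 != 0, Q`_0 != 0 &
            ps_div f1 f2 =1 ps_div (ps_of_poly P) (ps_of_poly Q)])).
Proof.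
split=> [V fV simV|S v f1 f2 simS hv _ v_even vk vh /ps_unitP f10 /ps_unitP
  f20].
  exact: simple_highest_lweight.
exact: (fin_dim_rational q_neq0 q_not_root simS hv v_even vk vh f10 f20).
Qed.
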